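(* Let $\delta\in\{\mathsf N,\mathsf D,\mathsf U,\mathsf X\}^n$ and let $u=(n,n-1,\dots,2,1)-(1,2,\dots,n-1,n)=\sum_{i\in[n]}(n+1-2i)\,\mathbf e_i\in\mathbb R^n$. When oriented in the direction $u$, the $1$-skeleton of the $\delta$-permutreehedron $\mathbb{PT}(\delta)$ is the Hasse diagram of the $\delta$-permutree lattice (where the vertex $\mathbf a(T)$ corresponds to the $\delta$-permutree $T$).
   Context: Permutrees. A decoration of size $n$ is a word $\delta=\delta_1\cdots\delta_n$ in the symbols $\mathsf N$ (none), $\mathsf D$ (down), $\mathsf U$ (up), $\mathsf X$ (both). A permutree is a directed tree $T$ with $n$ vertices labeled bijectively by $[n]=\{1,\dots,n\}$ (vertices are identified with labels) in which each vertex has one or two parents (outgoing neighbors) and one or two children (incoming neighbors); a parent or child may be an unlabeled leaf (dangling edge), so ancestor and descendant subtrees may be empty. The ancestor (resp. descendant) subtree of $i$ through a given parent (resp. child) is the whole connected component, reached through it, of the tree with $i$ removed; its size is its number of labeled vertices. If $i$ has two parents (resp. children), they are distinguished as left and right, and all labels in the left ancestor (resp. descendant) subtree of $i$ are smaller than $i$ while all labels in the right one are larger than $i$. The decoration of $T$ is given by $\delta(T)_i=\mathsf N,\mathsf D,\mathsf U,\mathsf X$ according to whether $i$ has (one parent, one child), (one parent, two children), (two parents, one child), (two parents, two children). A $\delta$-permutree is a permutree with decoration $\delta$. Permutreehedron. $\mathbb{PT}(\delta)$ is the convex hull of the points $\mathbf a(T)\in\mathbb R^n$ for all $\delta$-permutrees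 $T$; these points are its vertices. The coordinates are $\mathbf a(T)_i = 1+d$ if $\delta_i=\mathsf N$; $1+d+\underline\ell\,\underline r$ if $\delta_i=\mathsf D$; $1+d-\overline\ell\,\overline r$ if $\delta_i=\mathsf U$; $1+d+\underline\ell\,\underline r-\overline\ell\,\overline r$ if $\delta_i=\mathsf X$, where $d$ is the total size of the descendant subtree(s) of $i$, $\underline\ell,\underline r$ are the sizes of its left and right descendant subtrees (when $\delta_i\in\{\mathsf D,\mathsf X\}$), and $\overline\ell,\overline r$ are the sizes of its left and right ancestor subtrees (when $\delta_i\in\{\mathsf U,\mathsf X\}$). Permutree lattice. Let $i\to j$ be an edge of a $\delta$-permutree $T$ with $i<j$. Let $B$ be the only (resp. the right) descendant subtree of $i$ if $\delta_i\in\{\mathsf N,\mathsf U\}$ (resp. $\{\mathsf D,\mathsf X\}$), and $A$ the only (resp. the left) ancestor subtree of $j$ if $\delta_j\in\{\mathsf N,\mathsf D\}$ (resp. $\{\mathsf U,\mathsf X\}$). The increasing rotation of $i\to j$ transforms $T$ into the $\delta$-permutree $T'$ obtained by reversing the edge $i\to j$ into $j\to i$, attaching $A$ as ancestor subtree to $i$ (in the place of $j$) and $B$ as descendant subtree to $j$ (in the place of $i$). The $\delta$-permutree lattice is the order on $\delta$-permutrees which is the reflexive transitive closure of the relations $T<T'$ for all increasing rotations $T\to T'$. Orienting the $1$-skeleton in direction $u$ means that each edge is oriented from endpoint $p$ to endpoint $q$ when $\langle u,q-p\rangle>0$; the Hasse diagram is oriented increasingly. *)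

(* Defs.v *)
From HB Require Import structures.
From mathcomp Require Import all_boot all_order all_algebra.
From mathcomp Require Import boolp classical_sets reals convex.

Set Implicit Arguments.
Unset Strict Implicit.
Unset Printing Implicit Defensive.

Import Order.TTheory GRing.Theory Num.Theory.

(* Labels are 0-based: i : 'I_n stands for the label i + 1. *)

Inductive deco := DecN | DecD | DecU | DecX.

Definition two_children (c : deco) : bool :=
  match c with DecD | DecX => true | DecN | DecU => false end.

Definition two_parents (c : deco) : bool :=
  match c with DecU | DecX => true | DecN | DecD => false end.

Section DirectedTrees.
Local Open Scope set_scope.
Variable n : nat.
Implicit Types (E : {set 'I_n * 'I_n}) (i j : 'I_n).

(* (i, j) \in E is the edge i -> j: j is a parent of i, i a child of j. *)
Definition parents E i : {set 'I_n} := [set j | (i, j) \in E].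
Definition children E i : {set 'I_n} := [set j | (j, i) \in E].

Definition adjacent E : rel 'I_n := [rel i j | ((i, j) \in E) || ((j, i) \in E)].

(* The underlying graph is connected and acyclic.  Cycles without repeated
   vertices have at most n vertices.  Loops and pairs of opposite edges, i.e.
   cycles of length 1 and 2, have to be excluded apart, since for [ucycleb] any
   two adjacent vertices form a cycle of length 2. *)
Definition directed_tree E : bool :=
  [&& [forall i, forall j, ((i, j) \in E) ==> ((j, i) \notin E)],
      [forall i, forall j, connect (adjacent E) i j]
    & [forall m : 'I_n.+1, forall c : m.-tuple 'I_n,
         ucycleb (adjacent E) c ==> (m <= 2)]].

(* For a neighbor j of i, the connected component of j in the tree with i
   removed. *)
Definition component E i j : {set 'I_n} :=
  [set k | connect [rel a b | [&& adjacent E a b, a != i & b != i]] j k].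

(* The subtree reached through a leaf is empty, so that it can be omitted from
   the unions below. *)
Definition left_ancestors E i : {set 'I_n} :=
  \bigcup_(j in parents E i | j < i) component E i j.
Definition right_ancestors E i : {set 'I_n} :=
  \bigcup_(j in parents E i | i < j) component E i j.
Definition descendants E i : {set 'I_n} :=
  \bigcup_(j in children E i) component E i j.
Definition left_descendants E i : {set 'I_n} :=
  \bigcup_(j in children E i | j < i) component E i j.
Definition right_descendants E i : {set 'I_n} :=
  \bigcup_(j in children E i | i < j) component E i j.

End DirectedTrees.

Section Permutrees.
Local Open Scope set_scope.
Variables (n : nat) (delta : n.-tuple deco).

(* Leaves are implicit: delta gives the number of parents and of children of
   each vertex (leaves included), and those that are not endpoints of an edge
   of E are leaves. When there are two of them, an actual neighbor of i lies on
   the side given by comparing it with i, since it belongs to its own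
   subtree. *)
Definition is_permutree (E : {set 'I_n * 'I_n}) : bool :=
  directed_tree E &&
  [forall i : 'I_n,
     (if two_parents (tnth delta i) then
        [&& #|[set j in parents E i | j < i]| <= 1,
            #|[set j in parents E i | i < j]| <= 1,
            [forall k in left_ancestors E i, k < i]
          & [forall k in right_ancestors E i, i < k]]
      else #|parents E i| <= 1)
  &&
     (if two_children (tnth delta i) then
        [&& #|[set j in children E i | j < i]| <= 1,
            #|[set j in children E i | i < j]| <= 1,
            [forall k in left_descendants E i, k < i]
          & [forall k in right_descendants E i, i < k]]
      else #|children E i| <= 1)].

Record permutree := Permutree {
  permutree_edges :> {set 'I_n * 'I_n};
  _ : is_permutree permutree_edges }.

HB.instance Definition _ := [isSub for permutree_edges].
HB.instance Definition _ := [Finite of permutree by <:].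

(* The rotation of i -> j, for i < j. B and A consist of the root of the
   moved descendant subtree of i, resp. ancestor subtree of j; they are empty
   when this subtree is a leaf. *)
Definition rotate (E : {set 'I_n * 'I_n}) (i j : 'I_n) : {set 'I_n * 'I_n} :=
  let B := [set b in children E i | two_children (tnth delta i) ==> (i < b)] in
  let A := [set a in parents E j | two_parents (tnth delta j) ==> (a < j)] in
  (E :\: ([set (i, j)] :|: [set (b, i) | b in B] :|: [set (j, a) | a in A]))
  :|: ([set (j, i)] :|: [set (b, j) | b in B] :|: [set (i, a) | a in A]).

Definition increasing_rotation : rel permutree :=
  fun T T' => [exists i : 'I_n, exists j : 'I_n,
    [&& (i, j) \in permutree_edges T, i < j
      & permutree_edges T' == rotate (permutree_edges T) i j]].

Definition permutree_le : rel permutree := connect increasing_rotation.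

Definition permutree_hasse : rel permutree := fun T T' =>
  [&& T != T', permutree_le T T'
    & [forall S : permutree,
         (permutree_le T S && permutree_le S T') ==> ((S == T) || (S == T'))]].

End Permutrees.

Section Polytopes.
Local Open Scope classical_set_scope.
Local Open Scope ring_scope.
Variables (R : realType) (n : nat).
Implicit Types (P F S : set 'rV[R]_n) (p q c : 'rV[R]_n).

Definition inner (x y : 'rV[R]_n) : R := \sum_(i < n) x 0 i * y 0 i.

Definition convex_hull S : set 'rV[R]_n := smallest (@convex_set R 'rV[R]_n) S.

(* Nonempty faces: the sets of maximizers of a linear form over P. *)
Definition face P F : Prop :=
  F !=set0 /\
  exists c, F = [set x | P x /\ forall y, P y -> inner c y <= inner c x].

Definition polytope_vertex P p : Prop := face P [set p].

(* The 1-dimensional faces of a polytope are those that are segments with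
   distinct endpoints. *)
Definition polytope_edge P p q : Prop :=
  p <> q /\ face P (convex_hull [set p; q]).

Definition oriented_edge (u : 'rV[R]_n) P p q : Prop :=
  polytope_edge P p q /\ 0 < inner u (q - p).

End Polytopes.

Section Permutreehedron.
Local Open Scope ring_scope.
Variables (R : realType) (n : nat) (delta : n.-tuple deco).

Definition permutree_point (T : permutree delta) : 'rV[R]_n :=
  \row_(i < n)
    let d : R := #|descendants T i|%:R in
    let ld : R := #|left_descendants T i|%:R in
    let rd : R := #|right_descendants T i|%:R in
    let la : R := #|left_ancestors T i|%:R in
    let ra : R := #|right_ancestors T i|%:R in
    match tnth delta i with
    | DecN => 1 + d
    | DecD => 1 + d + ld * rd
    | DecU => 1 + d - la * ra
    | DecX => 1 + d + ld * rd - la * ra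
    end.

Definition permutreehedron : set 'rV[R]_n :=
  convex_hull (range permutree_point).

End Permutreehedron.

Arguments permutree_point R {n delta} T.
Arguments permutreehedron R {n} delta.

(* With 0-based i: (n, n-1, ..., 1) - (1, 2, ..., n). *)
Definition direction (R : realType) (n : nat) : 'rV[R]_n :=
  (\row_(i < n) ((n - i)%:R - i.+1%:R))%R.

(* Main.v *)
Require Import Defs.
From mathcomp Require Import all_boot all_order all_algebra.
From mathcomp Require Import reals.
From mathcomp Require Import zify ring lra.

Set Implicit Arguments.
Unset Strict Implicit.
Unset Printing Implicit Defensive.

Import Order.TTheory GRing.Theory Num.Theory.

(** Removing an edge [i -> j] from a directed tree splits the vertices into the
    side of [i] and the side of [j]. The side of [i] is called the cut of the edge;
    it is [component E j i]. The proof works with cuts throughout.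

    For an edge of a permutree [T], the sum of the coordinates of [a(S)] over the
    cut is minimal for [S = T] among all permutrees [S] with the same decoration,
    and equality holds exactly when the cut is a down-set of [S] ([mass_cut_ge0],
    [mass_cut_eq0]). To see this, let every edge of [S] carry upwards a flow equal
    to the product of the sizes of its two sides. Then twice the coordinate
    [a(S)_k] is [n + 1] plus the net flow into [k] ([permutree_point_flow]), so
    that the sum of the coordinates over a set [X] is controlled by the net flow
    out of [X]. This flow counts, over all ordered pairs [(x, y)], the upward steps
    of the path from [x] to [y] that leave [X], minus those that enter [X]
    ([sum_ascent]). Cuts have a convexity property that depends only on the
    decoration ([cut_delta_convex]), and for a set [X] with this property the
    contribution of [(x, y)] is at most 1 if [x] is in [X] and [y] is not, and at
    most 0 otherwise ([ascent_le]).

    Between [a(T)] and [a(S)], a linear form [c] changes by a combination of the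
    sums over the cuts of [T], whose coefficients are the differences of [c] along
    the edges of [T] ([inner_diff]). Hence a form that increases weakly along the
    edges of [T] is maximal at [a(T)], and the other maximizers are the [S] in
    which the cuts of the edges of strict increase are down-sets. If [c] increases
    strictly along all edges, this forces [S = T], because a tree is determined by
    the order that it generates ([permutree_of_cuts]); so the [a(T)] are distinct
    and are the vertices. If [c] is constant along one edge [i -> j] only, all
    maximizers lie on a line of direction [e_i - e_j]. This line contains [a(T)] and
    [a(T')], where [T'] is the rotation of [T] along this edge, and no third vertex
    fits on it ([one_cut_rotated]). So rotations give edges of the polytope
    ([rotated_edge]). Conversely, comparing [T] with its rotations shows that a
    form defining an edge at [a(T)] increases weakly along the edges of [T], and
    one of its edges of constancy yields the other end ([edge_rotated]). Rotating
    [i -> j] moves [a(T)] in the direction [e_i - e_j], on which the given direction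
    is positive if and only if [i < j] ([inner_direction_rotated]).

    It remains to see that increasing rotations are exactly the covers of the
    lattice ([permutree_hasseP]). Along increasing rotations, a relation [x] below
    [y] with [x < y] can only disappear. The rotation of [i -> j] destroys the
    relation between [i] and [j] but preserves the relations given by the other
    edges, so that no chain can reach its result by starting with another edge.

    Reversing all arrows exchanges children and parents; most properties of
    parents are obtained from those of children in this way. *)

(** * Directed trees and their cuts *)

Section Bridges.
Local Open Scope nat_scope.
Local Open Scope set_scope.
Variable n : nat.
Implicit Types (E : {set 'I_n * 'I_n}) (X : {set 'I_n}) (x y z p q : 'I_n).

Definition connected E := forall x y, connect (adjacent E) x y.

(** The set [X] is the side of [x] after removal of the edge from [x] to [y]. A
    connected graph is a tree as soon as all its edges have such a set, which is
    how rotations are shown to be trees. *)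
Definition bridge E x y X : Prop :=
  [/\ x \in X, y \notin X &
    forall p q, (p, q) \in E -> (p \in X) != (q \in X) -> p = x /\ q = y].

Definition reverse E : {set 'I_n * 'I_n} := [set e | (e.2, e.1) \in E].

Lemma in_reverse E x y : ((x, y) \in reverse E) = ((y, x) \in E).
Proof. by rewrite inE. Qed.

Lemma adjacentC E x y : adjacent E x y = adjacent E y x.
Proof. by rewrite /adjacent /= orbC. Qed.

Lemma connected_closed E X x y : connected E ->
  (forall p q, adjacent E p q -> p \in X -> q \in X) -> x \in X -> y \in X.
Proof.
move=> cE clX; have /connectP[s] := cE x y.
elim: s x => [|z s IH] x /=; first by move=> _ -> .
by case/andP=> xz sz y_last xX; apply: (IH z) => //; apply: clX xz xX.
Qed.

Lemma componentE E x z y :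
  y \in component E x z =
  connect [rel a b | [&& adjacent E a b, a != x & b != x]] z y.
Proof. by rewrite inE. Qed.

Lemma component_self E x z : z \in component E x z.
Proof. by rewrite componentE connect0. Qed.

Lemma component_step E x z p q : adjacent E p q -> p != x -> q != x ->
  p \in component E x z -> q \in component E x z.
Proof.
move=> pq px qx; rewrite !componentE => /connect_trans; apply.
by apply: connect1; rewrite /= px qx !andbT.
Qed.

Lemma component_sub E x z X :
  (forall p q, adjacent E p q -> p != x -> q != x -> p \in X -> q \in X) ->
  z \in X -> {subset component E x z <= X}.
Proof.
move=> clX + y; rewrite componentE => + /connectP[s].
elim: s z => [|w s IH] z /=; first by move=> zX _ ->.
move=> zX /andP[/and3P[zw zx wx] sw] yl; apply: (IH w) => //.
exact: clX zw zx wx zX.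
Qed.

Lemma component_notin E x z : z != x -> x \notin component E x z.
Proof.
move=> zx; suff: {subset component E x z <= predC1 x}.
  by move=> sub; apply/negP => /sub; rewrite inE eqxx.
move=> y /(@component_sub E x z [set~ x]); rewrite !inE; apply=> //.
by move=> p q _ _; rewrite !inE.
Qed.

Section Tree.
Variable E : {set 'I_n * 'I_n}.
Hypothesis tE : directed_tree E.

Lemma tree_antisym x y : (x, y) \in E -> (y, x) \notin E.
Proof.
by case/and3P: tE => /forallP/(_ x)/forallP/(_ y)/implyP.
Qed.

Lemma tree_irrefl x : (x, x) \notin E.
Proof. by apply/negP => xx; move: (tree_antisym xx); rewrite xx. Qed.

Lemma tree_neq x y : (x, y) \in E -> x != y.
Proof. by apply: contraL => /eqP->; apply: tree_irrefl. Qed.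

Lemma adjacent_neq x y : adjacent E x y -> x != y.
Proof. by case/orP => /tree_neq //; rewrite eq_sym. Qed.

Lemma tree_connected : connected E.
Proof.
by case/and3P: tE => _ /forallP c _ x y; move/forallP: (c x); apply.
Qed.

(** Otherwise a shortest path from [z] to [z'] avoiding [x] would close up to a
    cycle through [x]. *)
Lemma neighbor_unique x z z' :
  adjacent E x z -> adjacent E x z' -> z' \in component E x z -> z = z'.
Proof.
move=> xz xz'; rewrite componentE => /connectP[s0 s0P lst0].
apply/eqP; apply: contraT => zz'.
case/shortenP: s0P lst0 => s pS uS _ lst.
have xs : x \notin z :: s.
  rewrite inE negb_or adjacent_neq //=.
  elim: s (z) pS {lst zz' uS} => [|w s IH] // z1 /andP[/and3P[_ _ wx] ps].
  by rewrite inE negb_or eq_sym wx; apply: IH ps.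
have uc : uniq (x :: z :: s) by rewrite cons_uniq xs uS.
have sz : size (x :: z :: s) < n.+1.
  by rewrite ltnS -[X in _ <= X](card_ord n); move/card_uniqP: uc => <-;
    apply: max_card.
case/and3P: tE => _ _ /forallP/(_ (Ordinal sz))/forallP/(_ (in_tuple _))/implyP.
have cyc : ucycleb (adjacent E) (in_tuple (x :: z :: s)).
  rewrite /ucycleb uc andbT /= rcons_path.
  apply/and3P; split=> //; last by rewrite -lst -/(adjacent E z' x) adjacentC.
  by move: pS; apply: sub_path => a b /and3P[].
move/(_ cyc); rewrite /= ltnS ltnS leqn0 size_eq0 => /eqP sN.
by rewrite lst sN eqxx in zz'.
Qed.

Lemma component_disjoint x z z' y : adjacent E x z -> adjacent E x z' ->
  y \in component E x z -> y \in component E x z' -> z = z'.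
Proof.
move=> xz xz' yz yz'; apply: (neighbor_unique xz xz').
move: yz yz'; rewrite !componentE => yz yz'; apply: connect_trans yz _.
rewrite sym_connect_sym // => a b.
by rewrite /= adjacentC [(a != x) && _]andbC.
Qed.

Lemma component_neighbor x y : x != y ->
  exists2 z, adjacent E x z & y \in component E x z.
Proof.
move=> xy.
have: y \in x |: [set y | [exists z, adjacent E x z && (y \in component E x z)]].
  apply: (connected_closed (x := x) _ tree_connected); last by rewrite !inE eqxx.
  move=> p q pq; rewrite !inE; case: (eqVneq q x) => //= qx.
  case: (eqVneq p x) => [px _|px /existsP[z /andP[xz pz]]].
    by apply/existsP; exists q; rewrite component_self andbT -px.
  by apply/existsP; exists z; rewrite xz; apply: component_step pz.
by rewrite !inE eq_sym (negPf xy) => /existsP[z /andP[]]; exists z.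
Qed.

Lemma componentC x z : adjacent E x z -> component E z x = ~: component E x z.
Proof.
move=> xz; have xz' := adjacent_neq xz.
apply/setP => k; rewrite in_setC; apply/idP/idP => [|kN].
  rewrite -in_setC; apply: component_sub.
    move=> p q pq pz qz; rewrite !in_setC; apply: contraNN => qX.
    have qx : q != x.
      by apply: contraTneq qX => ->; rewrite component_notin // eq_sym.
    case: (eqVneq p x) => [px|px]; last first.
      by apply: component_step qX => //; rewrite adjacentC.
    move: qz; rewrite (neighbor_unique xz _ qX) ?eqxx //.
    by rewrite -px.
  by rewrite in_setC component_notin // eq_sym.
have: k \in component E x z :|: component E z x.
  apply: (connected_closed (x := x) _ tree_connected); last first.
    by rewrite inE component_self orbT.
  move=> p q pq; rewrite !in_setU.
  case: (eqVneq q x) => [->|qx]; first by rewrite component_self orbT.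
  case: (eqVneq q z) => [->|qz]; first by rewrite component_self.
  case/orP => pX.
    case: (eqVneq p x) => [px|px]; last by rewrite (component_step pq px qx pX).
    by move: pX; rewrite px (negPf (component_notin _ _)) // eq_sym.
  case: (eqVneq p z) => [pz|pz]; last by rewrite (component_step pq pz qz pX) orbT.
  by move: pX; rewrite pz (negPf (component_notin _ _)).
by rewrite in_setU (negPf kN).
Qed.

Lemma component_bridge x y : (x, y) \in E -> bridge E x y (component E y x).
Proof.
move=> xy; have axy : adjacent E x y by rewrite /adjacent /= xy.
have xNy := tree_neq xy.
split; rewrite ?component_self ?component_notin //.
suff cross p q : adjacent E p q -> p \in component E y x ->
    q \notin component E y x -> p = x /\ q = y.
  move=> p q pq; case pX: (p \in _); case qX: (q \in _) => // _.
    by apply: cross; rewrite ?pX ?qX // /adjacent /= pq.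
  have [|qx py] := cross q p _ qX (negbT pX); first by rewrite /adjacent /= pq orbT.
  by move: pq; rewrite qx py (negPf (tree_antisym xy)).
move=> pq pX qX.
have py : p != y by apply: contraTneq pX => ->; rewrite component_notin.
have qy : q = y.
  by apply: contraNeq qX => qy; apply: component_step pX.
split=> //; apply/esym/(@neighbor_unique y); rewrite // adjacentC //.
by rewrite -qy.
Qed.

(** The induction along the path from a vertex to a fixed target [y]. *)
Lemma ind_towards (P : 'I_n -> Prop) y : P y ->
  (forall x z, adjacent E x z -> y \in component E x z -> P z -> P x) ->
  forall x, P x.
Proof.
move=> Py IH x; case: (eqVneq x y) => [->//|xy].
have [z xz yz] := component_neighbor xy.
have [m] := ubnP #|component E x z|;
  elim: m x z xz yz {xy} => // m IHm x z xz yz cm.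
apply: (IH x z) => //; case: (eqVneq z y) => [->//|zy].
have [w zw yw] := component_neighbor zy.
apply: (IHm z w) => //; rewrite -ltnS; apply: leq_trans cm.
rewrite ltnS; apply: proper_card; apply/properP; split.
  apply/subsetP => k kw; apply: contraT => kx.
  rewrite -in_setC -componentC // in kx.
  have zx : adjacent E z x by rewrite adjacentC.
  by move: yw; rewrite (component_disjoint zw zx kw kx) componentC // in_setC yz.
by exists z; rewrite ?component_self // component_notin // eq_sym adjacent_neq.
Qed.

End Tree.

(** A cycle through the edge of a bridge would have to leave the bridge's
    set a second time. *)
Lemma bridge_no_cycle E x y z s X : bridge E x y X ->
  adjacent E x y -> uniq [:: x, y, z & s] ->
  ~~ cycle (adjacent E) [:: x, y, z & s].
Proof.
move=> [xX yX cross] xy /=.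
rewrite !inE !negb_or => /and4P[/and3P[xNy xNz xs] /andP[yNz ys] zs us].
apply/negP => /and3P[_ yz].
have zX : z \notin X.
  case/orP: yz => /cross; rewrite (negPf yX); case: (z \in X) => // -[] // e1 e2.
    by rewrite -e1 eqxx in xNy.
  by rewrite e1 eqxx in xNz.
elim: s z xNz xs yNz ys zX {yz zs us} => [|w s IH] z xNz xs yNz ys zX /=.
  rewrite andbT => /orP[] /cross; rewrite xX (negPf zX) => -[] // e1 e2.
    by rewrite e1 eqxx in xNz.
  by rewrite e2 eqxx in yNz.
move: xs ys; rewrite !inE !negb_or => /andP[xw xs] /andP[yw ys] /andP[zw].
apply: IH => //; case/orP: zw => /cross; rewrite (negPf zX);
  case: (w \in X) => // -[] // e1 e2.
  by rewrite e1 eqxx in xNz.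
by rewrite e1 eqxx in xw.
Qed.

Lemma adjacent_reverse E x y : adjacent (reverse E) x y = adjacent E x y.
Proof. by rewrite /adjacent /= !in_reverse orbC. Qed.

Lemma bridge_reverse E x y X : bridge E x y X -> bridge (reverse E) y x (~: X).
Proof.
case=> xX yX cross; split; rewrite ?inE ?yX ?negbK // => p q.
rewrite in_reverse => /cross; rewrite !inE.
by case: (p \in X) (q \in X) => [] [] // -[] // <- <-.
Qed.

Lemma tree_of_bridges E : connected E ->
  (forall x y, (x, y) \in E -> exists X, bridge E x y X) -> directed_tree E.
Proof.
move=> cE bE; apply/and3P; split.
- apply/forallP => x; apply/forallP => y; apply/implyP => xy.
  have [X [xX yX cross]] := bE _ _ xy.
  apply/negP => /cross; rewrite xX (negPf yX) => -[] // e _.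
  by rewrite e xX in yX.
- by apply/forallP => x; apply/forallP => y; apply: cE.
apply/forallP => m; apply/forallP => c; apply/implyP => /andP[cyc uc].
rewrite -(size_tuple c) leqNgt; apply/negP.
case: {m c}(tval c) cyc uc => [|x [|y [|z s]]] // cyc uc _.
have xy : adjacent E x y by case/andP: cyc.
case/orP: (xy) => exy; have [X bX] := bE _ _ exy.
  by move: cyc; apply/negP/(bridge_no_cycle bX).
have /negP := bridge_no_cycle (bridge_reverse bX) (etrans (adjacent_reverse _ _ _) xy) uc.
by apply; rewrite (eq_cycle (adjacent_reverse E)).
Qed.

Lemma bridge_component E x y X : connected E -> (x, y) \in E ->
  bridge E x y X -> component E y x = X.
Proof.
move=> cE xy [xX yX cross]; apply/setP/subset_eqP/andP; split; apply/subsetP.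
  apply: component_sub => // p q pq _ qy pX; apply: contraT => qX.
  case/orP: pq => /cross; rewrite pX (negPf qX) => -[] // e1 e2.
    by rewrite e2 eqxx in qy.
  by rewrite e2 (negPf yX) in pX.
move=> k kX; apply: contraT => kN.
have: y \in X :\: component E y x.
  apply: (connected_closed (x := k) _ cE); last by rewrite in_setD kN.
  move=> p q pq; rewrite !in_setD => /andP[pN pX].
  have py : p != y by apply: contraTneq pX => ->.
  have qX : q \in X.
    apply: contraT => qX; case/orP: pq => /cross;
      rewrite pX (negPf qX) => -[] // e1 e2.
      by rewrite e1 component_self in pN.
    by rewrite e1 xX in qX.
  rewrite qX andbT; apply: contraNN pN => qc.
  apply: component_step qc; rewrite // 1?adjacentC //.
  by apply: contraTneq qX => ->.
by rewrite inE (negPf yX) andbF.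
Qed.

End Bridges.

(** * Permutrees as trees with conditions exchanged by arrow reversal *)

Section Ptrees.
Local Open Scope nat_scope.
Local Open Scope set_scope.
Variable n : nat.
Implicit Types (E : {set 'I_n * 'I_n}) (X : {set 'I_n}).
Implicit Types (dn up : pred 'I_n) (x y z p q i j k a b : 'I_n).

(** The conditions on children and on parents are exchanged by reversing all arrows.
    The side of a neighbor [b] of [i] is encoded by the truth value of [b < i], so
    that uniqueness of neighbors has the same form for both decorations. *)
Record ptree dn up E : Prop := PTree {
  ptree_tree : directed_tree E;
  child_unique : forall i b b', (b, i) \in E -> (b', i) \in E ->
    (dn i -> (b < i) = (b' < i)) -> b = b';
  child_side : forall i b k, dn i -> (b, i) \in E ->
    k \in component E i b -> (k < i) = (b < i);
  parent_unique : forall i a a', (i, a) \in E -> (i, a') \in E ->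
    (up i -> (a < i) = (a' < i)) -> a = a';
  parent_side : forall i a k, up i -> (i, a) \in E ->
    k \in component E i a -> (k < i) = (a < i) }.

Lemma component_reverse E x y : component (reverse E) x y = component E x y.
Proof.
apply/setP => k; rewrite !inE; apply: eq_connect => a b /=.
by rewrite adjacent_reverse.
Qed.

Lemma tree_reverse E : directed_tree E -> directed_tree (reverse E).
Proof.
move=> tE; apply: tree_of_bridges.
  move=> x y; rewrite (eq_connect (e' := adjacent E)); last exact: adjacent_reverse.
  exact: tree_connected.
move=> x y; rewrite in_reverse => yx.
exists (~: component E x y); exact/bridge_reverse/component_bridge.
Qed.

Lemma ptree_reverse dn up E : ptree dn up E -> ptree up dn (reverse E).
Proof.
case=> tE cu cs pu ps; split; first exact: tree_reverse.
- by move=> i b b'; rewrite !in_reverse; apply: pu.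
- by move=> i b k ui; rewrite in_reverse component_reverse; apply: ps.
- by move=> i b b'; rewrite !in_reverse; apply: cu.
- by move=> i b k ui; rewrite in_reverse component_reverse; apply: cs.
Qed.

(** Of two subtrees, the rotation of the edge from [i] to [j] moves the one on the
    side of the other endpoint. Stated without assuming [i < j], this covers increasing
    and decreasing rotations alike and is exchanged by arrow reversal. *)
Definition moved_children dn E i j : {set 'I_n} :=
  [set b in children E i | dn i ==> ((b < i) == (j < i))].
Definition moved_parents up E i j : {set 'I_n} :=
  [set a in parents E j | up j ==> ((a < j) == (i < j))].

Definition rotation dn up E i j : {set 'I_n * 'I_n} :=
  let B := moved_children dn E i j in
  let A := moved_parents up E i j in
  (E :\: ([set (i, j)] :|: [set (b, i) | b in B] :|: [set (j, a) | a in A]))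
  :|: ([set (j, i)] :|: [set (b, j) | b in B] :|: [set (i, a) | a in A]).

Lemma moved_children_reverse up E i j :
  moved_children up (reverse E) j i = moved_parents up E i j.
Proof. by apply/setP => b; rewrite !inE. Qed.

Lemma moved_parents_reverse dn E i j :
  moved_parents dn (reverse E) j i = moved_children dn E i j.
Proof. by apply/setP => b; rewrite !inE. Qed.

Lemma pair_imsetl (B : {set 'I_n}) x y z :
  ((x, y) \in [set (b, z) | b in B]) = (y == z) && (x \in B).
Proof.
apply/imsetP/andP => [[b bB [-> ->]]|[/eqP-> xB]]; first by rewrite eqxx.
by exists x.
Qed.

Lemma pair_imsetr (B : {set 'I_n}) x y z :
  ((x, y) \in [set (z, b) | b in B]) = (x == z) && (y \in B).
Proof.
apply/imsetP/andP => [[b bB [-> ->]]|[/eqP-> xB]]; first by rewrite eqxx.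
by exists y.
Qed.

Lemma in_rotation dn up E i j x y :
  (x, y) \in rotation dn up E i j =
  [|| [&& (x, y) \in E, (x, y) != (i, j),
          ~~ ((y == i) && (x \in moved_children dn E i j))
        & ~~ ((x == j) && (y \in moved_parents up E i j))],
      (x == j) && (y == i), (y == j) && (x \in moved_children dn E i j)
    | (x == i) && (y \in moved_parents up E i j)].
Proof.
rewrite /rotation !in_setU in_setD !in_setU !in_set1 !pair_imsetl !pair_imsetr.
rewrite !negb_or -!andbA !xpair_eqE -!orbA.
by case: ((x, y) \in E); rewrite ?andbF ?andbT.
Qed.

Lemma rotation_reverse dn up E i j :
  rotation up dn (reverse E) j i = reverse (rotation dn up E i j).
Proof.
apply/setP => -[x y]; rewrite in_reverse !in_rotation.
rewrite in_reverse moved_children_reverse moved_parents_reverse !xpair_eqE.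
rewrite [(y == j) && (x == i)]andbC [(y == i) && (x == j)]andbC.
case: ((y, x) \in E) => /=; last by congr (_ || _); apply: orbC.
by congr [|| _ && _, _ | _]; [apply: andbC | apply: orbC].
Qed.

(** * Rotations of permutrees are permutrees *)

Definition down_closed E X : Prop :=
  forall a b, (a, b) \in E -> b \in X -> a \in X.

Lemma bridge_down_closed E x y X : bridge E x y X -> down_closed E X.
Proof.
case=> xX yX cross p q pq qX; apply: contraT => pX.
have [|e _] := cross p q pq; first by rewrite qX (negPf pX).
by rewrite e xX in pX.
Qed.

Lemma bridge_same E x y X p q : bridge E x y X -> (p, q) \in E ->
  (p, q) != (x, y) -> (p \in X) = (q \in X).
Proof.
case=> _ _ cross pq; apply: contraNeq => /(cross _ _ pq)[-> ->].
by rewrite eqxx.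
Qed.

Section Rotation.
Variables (dn up : pred 'I_n) (E : {set 'I_n * 'I_n}) (i j : 'I_n).
Hypotheses (pE : ptree dn up E) (ij : (i, j) \in E).
Local Notation A := (moved_parents up E i j).
Local Notation B := (moved_children dn E i j).
Local Notation E' := (rotation dn up E i j).
Let tE : directed_tree E := ptree_tree pE.

Lemma moved_childP b :
  reflect ((b, i) \in E /\ (dn i -> (b < i) = (j < i))) (b \in B).
Proof.
rewrite !inE; apply: (iffP andP) => -[bi h]; split=> //.
  by move=> /(implyP h)/eqP.
by apply/implyP => /h ->.
Qed.

Lemma moved_parentP a :
  reflect ((j, a) \in E /\ (up j -> (a < j) = (i < j))) (a \in A).
Proof.
rewrite !inE; apply: (iffP andP) => -[ja h]; split=> //.
  by move=> /(implyP h)/eqP.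
by apply/implyP => /h ->.
Qed.

Inductive rotation_spec x y : Prop :=
| RotationKept of (x, y) \in E & (x, y) != (i, j)
    & ~ (y = i /\ x \in B) & ~ (x = j /\ y \in A)
| RotationFlip of x = j & y = i
| RotationChild of y = j & x \in B
| RotationParent of x = i & y \in A.

Lemma rotationP x y : reflect (rotation_spec x y) ((x, y) \in E').
Proof.
rewrite in_rotation; apply: (iffP or4P).
  case=> [/and4P[xy ne h1 h2]|/andP[/eqP-> /eqP->]|/andP[/eqP-> h]|/andP[/eqP-> h]].
  - apply: RotationKept => // -[e h]; first by move: h1; rewrite e eqxx h.
    by move: h2; rewrite e eqxx h.
  - exact: RotationFlip.
  - exact: RotationChild.
  - exact: RotationParent.
case=> [xy ne h1 h2|-> ->|-> h|-> h].
- constructor 1; rewrite xy ne /=; apply/andP; split.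
    by apply/negP => /andP[/eqP e h]; apply: h1.
  by apply/negP => /andP[/eqP e h]; apply: h2.
- by constructor 2; rewrite !eqxx.
- by constructor 3; rewrite eqxx.
- by constructor 4; rewrite eqxx.
Qed.

Lemma rotation_flip : (j, i) \in E'.
Proof. exact/rotationP/RotationFlip. Qed.

(** The edges of the rotation that cross a bridge of another edge come from this
    edge: as [i] and [j] are on the same side, a moved edge crosses the bridge if
    and only if its original does. *)
Lemma rotation_cross x y X p q : bridge E x y X -> (x, y) != (i, j) ->
  (p, q) \in E' -> (p \in X) != (q \in X) ->
  [\/ [/\ p = x, q = y, ~ (y = i /\ x \in B) & ~ (x = j /\ y \in A)],
      [/\ q = j, p \in B, x = p & y = i]
    | [/\ p = i, q \in A, x = j & y = q]].
Proof.
move=> bX ne; have eqij : (i \in X) = (j \in X).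
  by apply: (bridge_same bX ij); rewrite eq_sym.
have [_ _ cross] := bX.
case/rotationP => [pq ne' h1 h2|-> ->|-> pB|-> qA].
- by move/(cross _ _ pq) => [ep eq]; subst; constructor 1.
- by rewrite eqij eqxx.
- have [pi _] := moved_childP _ pB.
  by rewrite -eqij => /(cross _ _ pi)[<- <-]; constructor 2.
- have [jq _] := moved_parentP _ qA.
  by rewrite eqij => /(cross _ _ jq)[<- <-]; constructor 3.
Qed.

Lemma bridge_kept x y : (x, y) \in E -> (x, y) != (i, j) ->
  ~ (y = i /\ x \in B) -> ~ (x = j /\ y \in A) ->
  bridge E' x y (component E y x).
Proof.
move=> xy ne h1 h2; have bX := component_bridge tE xy.
have [xX yX _] := bX; split=> // p q pq cr.
have [[]|[_ pB ex ey]|[_ qA ex ey]] // := rotation_cross bX ne pq cr.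
  by case: h1; rewrite ex.
by case: h2; rewrite ey.
Qed.

Lemma bridge_child b : b \in B -> bridge E' b j (component E i b).
Proof.
move=> bB; have [bi _] := moved_childP _ bB; have bX := component_bridge tE bi.
have ne : (b, i) != (i, j).
  by apply: contraNneq (tree_irrefl tE i) => -[e _]; rewrite -{1}e.
have [bX1 iX _] := bX; split=> //.
  by rewrite -(bridge_same bX ij) // eq_sym.
move=> p q pq cr.
have [[_ _ []]|[-> _ -> _]|[_ _ e _]] // := rotation_cross bX ne pq cr.
by move: (tree_antisym tE ij); rewrite -e bi.
Qed.

Lemma bridge_parent a : a \in A -> bridge E' i a (component E a j).
Proof.
move=> aA; have [ja _] := moved_parentP _ aA; have bX := component_bridge tE ja.
have ne : (j, a) != (i, j).
  by apply: contraNneq (tree_irrefl tE j) => -[_ e]; rewrite -{2}e.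
have [jX aX _] := bX; split=> //.
  by rewrite (bridge_same bX ij) // eq_sym.
move=> p q pq cr.
have [[_ _ _ []]|[_ _ _ e]|[-> _ _ ->]] // := rotation_cross bX ne pq cr.
by move: (tree_antisym tE ij); rewrite -e ja.
Qed.

(** The vertices on the side of [j] once the edge between [i] and [j] is
    reversed: those that were there already, except for the subtree taken over
    by [i], together with the subtree taken over from [i]. *)
Definition flipped_side : {set 'I_n} :=
  [set k | (k \in component E i j) && [forall a in A, k \notin component E j a]
           || [exists b in B, k \in component E i b]].

Lemma adjij : adjacent E i j. Proof. by rewrite /adjacent /= ij. Qed.
Lemma adjji : adjacent E j i. Proof. by rewrite adjacentC adjij. Qed.

Lemma moved_child_edge b : b \in B -> (b, i) \in E.
Proof. by case/moved_childP. Qed.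
Lemma moved_parent_edge a : a \in A -> (j, a) \in E.
Proof. by case/moved_parentP. Qed.
Lemma moved_child_adj b : b \in B -> adjacent E i b.
Proof. by move/moved_child_edge => bi; rewrite /adjacent /= bi orbT. Qed.
Lemma moved_parent_adj a : a \in A -> adjacent E j a.
Proof. by move/moved_parent_edge => ja; rewrite /adjacent /= ja. Qed.

Lemma moved_child_neq b : b \in B -> b != j.
Proof.
move/moved_child_edge => bi; apply: contraNneq (tree_antisym tE ij).
by move=> <-.
Qed.
Lemma moved_parent_neq a : a \in A -> a != i.
Proof.
move/moved_parent_edge => ja; apply: contraNneq (tree_antisym tE ij).
by move=> <-.
Qed.

Lemma component_edge_same x y p q : (x, y) \in E -> (p, q) \in E ->
  (p, q) != (x, y) -> (p \in component E x y) = (q \in component E x y).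
Proof.
move=> xy pq ne; have ayx : adjacent E y x by rewrite /adjacent /= xy orbT.
rewrite (componentC tE ayx) !in_setC; congr (~~ _).
exact: (bridge_same (component_bridge tE xy)).
Qed.

Lemma in_flipped_side k : (k \in flipped_side) =
  (k \in component E i j) && [forall a in A, k \notin component E j a]
  || [exists b in B, k \in component E i b].
Proof. by rewrite {1}in_set. Qed.

Lemma bridge_flip : bridge E' j i flipped_side.
Proof.
have jF : j \in flipped_side.
  rewrite in_flipped_side component_self; apply/orP; left; apply/forall_inP => a aA.
  by rewrite component_notin // eq_sym (adjacent_neq tE) // moved_parent_adj.
have iB : [exists b in B, i \in component E i b] = false.
  apply/negbTE; rewrite negb_exists_in; apply/forall_inP => b bB.
  by rewrite component_notin // eq_sym (adjacent_neq tE) // moved_child_adj.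
have iF : i \notin flipped_side.
  rewrite in_flipped_side iB orbF negb_and component_notin //.
  exact: (adjacent_neq tE adjji).
split=> // p q /rotationP[pq ne h1 h2|-> ->|-> pB|-> qA] //; move=> /eqP[].
- rewrite !in_flipped_side (component_edge_same ij pq ne); congr (_ && _ || _).
    apply: eq_forallb => a; case: (boolP (a \in A)) => //= aA; congr (~~ _).
    apply: component_edge_same (moved_parent_edge aA) pq _.
    by apply/eqP => -[e1 e2]; apply: h2; rewrite e1 e2.
  apply: eq_existsb => b; case: (boolP (b \in B)) => //= bB.
  apply: (bridge_same (component_bridge tE (moved_child_edge bB)) pq).
  by apply/eqP => -[e1 e2]; apply: h1; rewrite e1 e2.
- rewrite jF in_flipped_side; apply/orP; right; apply/exists_inP.
  by exists p; rewrite ?component_self.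
rewrite (negbTE iF); apply/esym/negbTE; rewrite in_flipped_side negb_or negb_and.
apply/andP; split.
  apply/orP; right; rewrite negb_forall_in; apply/exists_inP.
  by exists q; rewrite // negbK component_self.
rewrite negb_exists_in; apply/forall_inP => b bB; apply/negP => qb.
have qj : q \in component E i j.
  rewrite -(component_edge_same ij (moved_parent_edge qA)) ?component_self //.
  by apply/eqP => -[_ e]; rewrite e in qA; move: (tree_irrefl tE j);
    rewrite moved_parent_edge.
have := component_disjoint tE adjij (moved_child_adj bB) qj qb.
by move=> e; move: (moved_child_neq bB); rewrite e eqxx.
Qed.

Lemma rotation_connected : connected E'.
Proof.
have sE' : connect_sym (adjacent E').
  by apply: sym_connect_sym => x y; rewrite adjacentC.
have adjE' x y : (x, y) \in E' -> connect (adjacent E') x y.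
  by move=> xy; apply: connect1; rewrite /adjacent /= xy.
have EE' x y : (x, y) \in E -> connect (adjacent E') x y.
  have fl := adjE' _ _ rotation_flip; have fl' := fl; rewrite sE' in fl'.
  move=> xy; case: (eqVneq (x, y) (i, j)) => [[-> ->] //|ne].
  have [/andP[/eqP-> xB]|h1] := boolP ((y == i) && (x \in B)).
    apply: connect_trans fl; apply/adjE'/rotationP; exact: RotationChild.
  have [/andP[/eqP-> yA]|h2] := boolP ((x == j) && (y \in A)).
    apply: connect_trans fl _; apply/adjE'/rotationP; exact: RotationParent.
  apply/adjE'/rotationP/RotationKept => // -[e h].
    by move: h1; rewrite e eqxx h.
  by move: h2; rewrite e eqxx h.
move=> x y; move: (tree_connected tE x y); apply: connect_sub => {}x {}y.
by case/orP => /EE' //; rewrite sE'.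
Qed.

Lemma rotation_tree : directed_tree E'.
Proof.
apply: tree_of_bridges rotation_connected _ => x y.
case/rotationP => [xy ne h1 h2|-> ->|-> xB|-> yA].
- by exists (component E y x); apply: bridge_kept.
- by exists flipped_side; apply: bridge_flip.
- by exists (component E i x); apply: bridge_child.
- by exists (component E y j); apply: bridge_parent.
Qed.

Lemma val_neq x y : x != y -> (x : nat) <> y.
Proof. by move=> xy /val_inj e; rewrite e eqxx in xy. Qed.

Lemma far_side z : (z < j) != (i < j) -> (z < i) = (j < i).
Proof. by have := val_neq (tree_neq tE ij); clear; lia. Qed.

Lemma moved_child_side b z : dn j -> b \in B -> z \in component E i b ->
  (z < j) = (i < j).
Proof.
move=> dj bB zb; apply: (child_side pE dj ij); apply: contraT => zN.
move: zN; rewrite (componentC tE adjij) in_setC negbK => zj.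
move: (moved_child_neq bB).
by rewrite (component_disjoint tE (moved_child_adj bB) adjij zb zj) eqxx.
Qed.

Lemma moved_parent_side a : dn a -> a \in A -> (i < a) = (j < a).
Proof.
move=> da aA; apply: (child_side pE da (moved_parent_edge aA)).
by have [] := bridge_parent aA.
Qed.

(** Between [j] and such a vertex [z], the path leaves [j] on the side opposite
    to [i]: otherwise the neighbor of [j] on this path would be among the moved
    parents, or would be [i]. *)
Lemma beyond_flip z : z \in component E i j ->
  (forall a, a \in A -> z \notin component E j a) ->
  j = z \/ (z < j) != (i < j).
Proof.
move=> zj zA; case: (eqVneq j z) => [|jz]; [by left | right].
have [w jw zw] := component_neighbor tE jz.
have wi : w != i.
  apply: contraTneq zw => ->.
  by rewrite (componentC tE adjij) in_setC negbK.
have wA : w \notin A by apply: contraL zw => /zA.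
case/orP: jw => ew.
  have : up j && ((w < j) != (i < j)).
    apply: contraNT wA; rewrite negb_and negbK => h.
    by apply/moved_parentP; split=> // uj; move: h; rewrite uj => /eqP.
  by case/andP => uj; rewrite (parent_side pE uj ew zw).
have : dn j && ((w < j) != (i < j)).
  apply: contraNT wi; rewrite negb_and negbK => h; apply/eqP.
  by apply: (child_unique pE ew ij) => dj; move: h; rewrite dj => /eqP.
by case/andP => dj; rewrite (child_side pE dj ew zw).
Qed.

(** The component to be bounded is the side of the bridge of the edge in question:
    a cut of [E] for old and moved edges, [flipped_side] for the new edge. *)
Lemma rotation_child_side k b z : dn k -> (b, k) \in E' ->
  z \in component E' k b -> (z < k) = (b < k).
Proof.
have comp x y X : (x, y) \in E' -> bridge E' x y X -> component E' y x = X.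
  exact: bridge_component rotation_connected.
move=> dk bk; case/rotationP: (bk) => [bkE ne h1 h2|eb ek|ek bB|eb kA].
- by rewrite (comp _ _ _ bk (bridge_kept bkE ne h1 h2));
  apply: child_side pE _ _ _ _ _.
- rewrite eb ek in bk dk *; rewrite (comp _ _ _ bk bridge_flip) in_flipped_side.
  case/orP => [/andP[zj /forall_inP zA]|/exists_inP[c cB zc]]; last first.
    have [ci h] := moved_childP _ cB.
    by rewrite (child_side pE dk ci zc) h.
  by case: (beyond_flip zj zA) => [->//|]; apply: far_side.
- rewrite ek in bk dk *; rewrite (comp _ _ _ bk (bridge_child bB)) => zb.
  by rewrite !(moved_child_side dk bB) ?component_self.
- rewrite eb in bk *; rewrite (comp _ _ _ bk (bridge_parent kA)) => zj.
  have kj := moved_parent_edge kA.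
  by rewrite (child_side pE dk kj zj) moved_parent_side.
Qed.

Lemma rotation_child_unique k b c : (b, k) \in E' -> (c, k) \in E' ->
  (dn k -> (b < k) = (c < k)) -> b = c.
Proof.
have flip_kept d : (d, i) \in E -> d \notin B -> (dn i -> (j < i) = (d < i)) ->
    False.
  by move=> di /negP dB h; apply: dB; apply/moved_childP; split=> // /h ->.
have child_kept d e : d \in B -> (e, j) \in E -> (e, j) != (i, j) ->
    (dn j -> (d < j) = (e < j)) -> False.
  move=> dB ej /eqP ne h; apply: ne; rewrite (child_unique pE ej ij) // => dj.
  by rewrite -h // (moved_child_side dj dB) ?component_self.
have parent_kept d : k \in A -> (d, k) \in E -> ~ (d = j /\ k \in A) ->
    (dn k -> (i < k) = (d < k)) -> False.
  move=> kA dk ne h; apply: ne; split=> //.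
  apply: (child_unique pE dk (moved_parent_edge kA)) => dnk.
  by rewrite -h // moved_parent_side.
have jA : j \notin A.
  by apply/negP => /moved_parent_edge; apply/negP/(tree_irrefl tE).
have iA : i \notin A by apply/negP => /moved_parent_neq; rewrite eqxx.
case/rotationP => [bk ne1 h1 g1|eb ek|ek bB|eb kA];
  case/rotationP => [ck ne2 h2 g2|ec ek'|ek' cB|ec kA'] side //.
- exact: (child_unique pE bk ck side).
- subst; case: (@flip_kept b) => //; last by move=> /side ->.
  by apply/negP => bB; apply: h1.
- by subst; case: (@child_kept c b) => // /side ->.
- by subst; case: (@parent_kept b) => // /side ->.
- subst; case: (@flip_kept c) => //.
  by apply/negP => cB; apply: h2.
- by subst.
- by move: (tree_neq tE ij); rewrite -ek ek' eqxx.
- by rewrite ek (negPf iA) in kA'.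
- by subst; case: (@child_kept b c).
- by move: (tree_neq tE ij); rewrite -ek ek' eqxx.
- apply: (child_unique pE (moved_child_edge bB) (moved_child_edge cB)).
  by have [_ hb] := moved_childP _ bB; have [_ hc] := moved_childP _ cB => di;
    rewrite hb ?hc.
- by rewrite ek (negPf jA) in kA'.
- by subst; case: (@parent_kept c).
- by rewrite ek' (negPf iA) in kA.
- by rewrite ek' (negPf jA) in kA.
- by rewrite eb ec.
Qed.

Lemma rotation_cut_down_closed x y : (x, y) \in E -> (x, y) != (i, j) ->
  down_closed E' (component E y x).
Proof.
move=> xy ne p q pq qX; have bX := component_bridge tE xy.
have eqij : (i \in component E y x) = (j \in component E y x).
  by apply: (bridge_same bX ij); rewrite eq_sym.
have [xX _ _] := bX; apply: contraT => pX.
have cr : (p \in component E y x) != (q \in component E y x).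
  by rewrite qX (negPf pX).
case: (rotation_cross bX ne pq cr) => [[e _ _ _]|[_ _ e _]|[e _ ex _]].
- by rewrite e xX in pX.
- by rewrite -e xX in pX.
- by rewrite e eqij -ex xX in pX.
Qed.

(** The order generated by the arrows. *)
Definition ascends (E0 : {set 'I_n * 'I_n}) : rel 'I_n :=
  connect [rel x y | (x, y) \in E0].

Lemma rotation_kept_ascends x y : (x, y) \in E -> (x, y) != (i, j) ->
  ascends E' x y.
Proof.
move=> xy ne.
have edge p q : rotation_spec p q -> ascends E' p q.
  by move=> pq; apply/connect1/rotationP.
have fl : ascends E' j i by apply: edge; apply: RotationFlip.
have [/andP[/eqP-> xB]|h1] := boolP ((y == i) && (x \in B)).
  by apply: connect_trans fl; apply: edge; apply: RotationChild.
have [/andP[/eqP-> yA]|h2] := boolP ((x == j) && (y \in A)).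
  by apply: connect_trans fl _; apply: edge; apply: RotationParent.
apply/edge/RotationKept => // -[e h].
  by move: h1; rewrite e eqxx h.
by move: h2; rewrite e eqxx h.
Qed.

End Rotation.

(** The conditions on parents follow from those on children by reversing all
    arrows, since this exchanges the roles of [i] and [j] in the rotation. *)
Lemma rotation_ptree dn up E i j : ptree dn up E -> (i, j) \in E ->
  ptree dn up (rotation dn up E i j).
Proof.
move=> pE ij; have pE' := ptree_reverse pE.
have ji : (j, i) \in reverse E by rewrite in_reverse.
split; first exact: rotation_tree.
- by move=> k b c; apply: rotation_child_unique.
- by move=> k b z; apply: rotation_child_side.
- move=> k a c ka kc h; apply: (rotation_child_unique pE' ji (k := k)) => //.
    by rewrite rotation_reverse in_reverse.
  by rewrite rotation_reverse in_reverse.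
- move=> k a z uk ka za; apply: (rotation_child_side pE' ji (k := k)) => //.
    by rewrite rotation_reverse in_reverse.
  by rewrite rotation_reverse component_reverse.
Qed.

(** * The convexity of cuts *)

(** A vertex with two children forbids the paths below it to pass from one side of
    its label to the other, unless they go through the vertex itself. This and the
    dual condition depend on the decoration only, so that they carry over from the
    cuts of a permutree to all permutrees with the same decoration. *)
Definition half_convex dn X : Prop := forall v p q,
  dn v -> v \notin X -> p \in X -> q \in X -> p < v -> v < q -> False.

Definition delta_convex dn up X : Prop :=
  half_convex dn X /\ half_convex up (~: X).

Lemma component_avoid E a b z w : directed_tree E -> (a, b) \in E ->
  z \notin component E b a -> a \in component E z w ->
  {subset component E b a <= component E z w}.
Proof.
move=> tE ab zN aw.
have [aX bX cross] := component_bridge tE ab.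
suff sub : {subset component E b a <=
                   component E z w :|: ~: component E b a}.
  by move=> k kX; move: (sub k kX); rewrite in_setU in_setC kX orbF.
apply: component_sub; last by rewrite in_setU aw.
move=> p q pq pb qb; rewrite !in_setU !in_setC.
case: (boolP (q \in component E b a)) => qX; rewrite ?orbT //= !orbF.
have pX : p \in component E b a.
  apply: contraT => pX.
  case/orP: (pq) => /cross; rewrite qX (negPf pX) => -[] // e1 e2.
    by rewrite e2 (negPf bX) in qX.
  by rewrite e2 eqxx in pb.
rewrite pX orbF => pw; apply: (component_step pq _ _ pw).
  by apply: contraNneq zN => <-.
by apply: contraNneq zN => <-.
Qed.

(** The path from [v] to the edge leaves [v] either by a child, and then the
    cut lies on one side of [v], or upwards. In the latter case it turns down
    at some vertex [w], and [w] separates [v] from the cut. *)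
Lemma cut_half_convex dn up E a b : ptree dn up E -> (a, b) \in E ->
  half_convex dn (component E b a).
Proof.
move=> pE ab; have tE := ptree_tree pE.
have [aX bX cross] := component_bridge tE ab.
set X := component E b a in aX bX cross *.
have turn v : v \notin X -> forall z, (v, z) \in E -> a \in component E v z ->
    exists (w : 'I_n) (s : bool),
      (forall k, k \in component E z v -> (k < w) = s /\ k != w)
      /\ (forall l, l \in X -> (l < w) = ~~ s /\ l != w).
  move: v; apply: (ind_towards tE (y := a)) => [|x z0 xz0 az0 IH xX z xz az].
    by rewrite aX.
  have axz : adjacent E x z by rewrite /adjacent /= xz.
  have azx : adjacent E z x by rewrite adjacentC.
  have ez := component_disjoint tE axz xz0 az az0; subst z0.
  have zX : z \notin X.
    apply/negP => zX; case: (cross _ _ xz); first by rewrite zX (negPf xX).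
    by move=> ex; rewrite ex aX in xX.
  have za : z != a by apply: contraNneq zX => ->.
  have [y zy ay] := component_neighbor tE za.
  have xNy : x != y.
    by apply: contraTneq ay => <-; rewrite (componentC tE axz) in_setC negbK.
  have subX : {subset X <= component E z y} by apply: component_avoid.
  have neq k c : adjacent E z c -> k \in component E z c -> k != z.
    move=> zc; apply: contraTneq => ->.
    by rewrite component_notin // eq_sym (adjacent_neq tE zc).
  case/orP: (zy) => ezy.
    have [w [s [h1 h2]]] := IH zX y ezy ay.
    exists w, s; split=> // k kx; apply: h1.
    rewrite (componentC tE zy) in_setC; apply: contra_neqN xNy => ky.
    exact: (component_disjoint tE azx zy kx ky).
  have : dn z && ((x < z) != (y < z)).
    apply: contraNT xNy; rewrite negb_and negbK => h; apply/eqP.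
    by apply: (child_unique pE xz ezy) => dz; move: h; rewrite dz => /eqP.
  case/andP => dz xyz; exists z, (x < z); split=> [k kx|l /subX ly].
    by rewrite (child_side pE dz xz kx) (neq _ _ azx).
  rewrite (child_side pE dz ezy ly) (neq _ _ zy) //; split=> //.
  by move: xyz; case: (x < z); case: (y < z).
move=> v p q dv vX pX qX pv vq.
have va : v != a by apply: contraNneq vX => ->.
have [z vz az] := component_neighbor tE va.
have subX := component_avoid tE ab vX az.
case/orP: (vz) => evz; last first.
  have := child_side pE dv evz (subX _ pX).
  have := child_side pE dv evz (subX _ qX).
  by clear -pv vq; lia.
have [w [s [h1 h2]]] := turn v vX z evz az.
have [vw /val_neq vNw] := h1 v (component_self _ _ _).
have [pw /val_neq pNw] := h2 p pX; have [qw /val_neq qNw] := h2 q qX.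
by clear -pv vq vw pw qw vNw pNw qNw; case: s vw pw qw => /=; lia.
Qed.

Lemma cut_delta_convex dn up E a b : ptree dn up E -> (a, b) \in E ->
  delta_convex dn up (component E b a).
Proof.
move=> pE ab; split; first exact: cut_half_convex pE ab.
have aba : adjacent E b a by rewrite /adjacent /= ab orbT.
rewrite -(componentC (ptree_tree pE) aba) -component_reverse.
by apply: (cut_half_convex (ptree_reverse pE)); rewrite in_reverse.
Qed.

(** * Ascents along paths *)

Section Ascent.
Local Open Scope ring_scope.
Variable R : realDomainType.

(** The difference of [c] along a path is the sum of its differences along the
    edges of the path, and these are the edges whose cut separates the ends. *)
Lemma cut_decomposition E (c : 'I_n -> R) x y : directed_tree E ->
  c x - c y = \sum_(e in E) (c e.1 - c e.2) *
    ((x \in component E e.2 e.1)%:R - (y \in component E e.2 e.1)%:R).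
Proof.
move=> tE.
pose h k := c k - \sum_(e in E) (c e.1 - c e.2) * (k \in component E e.2 e.1)%:R.
have edge p q : (p, q) \in E -> h p = h q.
  move=> pq; rewrite /h (bigD1 (p, q)) //= [in RHS](bigD1 (p, q)) //=.
  have pNq : q != p by rewrite eq_sym (tree_neq tE).
  rewrite component_self (negPf (component_notin _ _)) 1?eq_sym // mulr1 mulr0.
  rewrite add0r opprD addrA subKr; congr (_ - _);
    apply: eq_bigr => -[a b] /= /andP[ab ne].
  congr (_ * _%:R); congr (nat_of_bool _).
  by apply: (bridge_same (component_bridge tE ab) pq); rewrite eq_sym.
have : x \in [set k | h k == h y].
  apply: (connected_closed (x := y) _ (tree_connected tE)); last by rewrite inE.
  by move=> p q /orP[] /edge e; rewrite !inE e.
rewrite inE => /eqP; rewrite /h.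
by under [in X in _ -> X]eq_bigr => e _ do rewrite mulrBr; rewrite sumrB; lra.
Qed.

(** Along the path from [x] to [y], the number of edges traversed upwards that
    leave [X], minus the number of those that enter [X]. *)
Definition ascent E X x y : R :=
  \sum_(e in E) ((x \in component E e.2 e.1) && (y \in component E e.1 e.2))%:R *
    ((e.1 \in X)%:R - (e.2 \in X)%:R).

Lemma ascent_step E X x y z : directed_tree E -> adjacent E x z ->
  y \in component E x z ->
  ascent E X x y = ascent E X z y +
    (if (x, z) \in E then (x \in X)%:R - (z \in X)%:R else 0).
Proof.
move=> tE xz yz; have xNz := adjacent_neq tE xz.
have yx : (y \in component E z x) = false.
  by rewrite (componentC tE xz) in_setC yz.
have same e : e \in E -> e != (x, z) -> e != (z, x) ->
    (x \in component E e.2 e.1) = (z \in component E e.2 e.1).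
  case: e => a b ab ne1 ne2; have br := component_bridge tE ab.
  by case/orP: xz => exz; [|symmetry]; apply: (bridge_same br exz); rewrite eq_sym.
case: ifP => exz.
  rewrite /ascent (bigD1 (x, z)) //= [in RHS](bigD1 (x, z)) //=.
  rewrite component_self yz (negPf (component_notin _ _)) // mul0r mul1r add0r.
  rewrite addrC; congr (_ + _); apply: eq_bigr => e /andP[eE ne].
  rewrite same //; apply: contraTneq eE => ->; exact: (tree_antisym tE exz).
have ezx : (z, x) \in E by move: xz; rewrite /adjacent /= exz.
rewrite addr0 /ascent (bigD1 (z, x)) //= [in RHS](bigD1 (z, x)) //=.
rewrite component_self yx (negPf (component_notin _ _)) 1?eq_sym // !mul0r.
congr (_ + _); apply: eq_bigr => e /andP[eE ne].
by rewrite same //; apply: contraTneq eE => ->; rewrite exz.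
Qed.

Lemma ascent_refl E X x : directed_tree E -> ascent E X x x = 0.
Proof.
move=> tE; apply: big1 => -[a b] /= ab.
have aba : adjacent E a b by rewrite /adjacent /= ab.
by rewrite (componentC tE aba) in_setC andNb mul0r.
Qed.

Lemma ascentB E X x y : directed_tree E ->
  ascent E X x y - ascent E X y x = (x \in X)%:R - (y \in X)%:R.
Proof.
move=> tE; rewrite (cut_decomposition (fun k => (k \in X)%:R) _ _ tE).
rewrite /ascent -sumrB; apply: eq_bigr => -[a b] /= ab.
have aba : adjacent E b a by rewrite /adjacent /= ab orbT.
rewrite (componentC tE aba) !in_setC -mulrBl mulrC; congr (_ * _).
by case: (x \in _); case: (y \in _); rewrite /= ?subrr.
Qed.

Lemma ascent_reverse E X x y :
  ascent (reverse E) (~: X) y x = ascent E X x y.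
Proof.
rewrite /ascent [LHS](reindex_inj (h := fun e : 'I_n * 'I_n => (e.2, e.1))).
  apply: eq_big => [[a b]|[a b] _] /=; first by rewrite in_reverse.
  rewrite !component_reverse andbC !in_setC; congr (_ * _).
  by case: (a \in X); case: (b \in X); rewrite /= ?subrr ?sub0r ?subr0 ?opprK.
by move=> [a b] [c d] [-> ->].
Qed.

(** Suppose that [x] is outside [X] and reached upwards from a subtree that meets
    [X]. The path to [y] cannot turn down at [x], since [x] would separate [y] from
    an element of [X]; it thus has to enter [X] upwards before it turns down. Each
    step out of [X] is compensated in this way. *)
Lemma ascent_le0 dn up E X y : ptree dn up E -> half_convex dn X -> y \in X ->
  forall x, ascent E X x y <= 0.
Proof.
move=> pE cX yX; have tE := ptree_tree pE.
suff main x : ascent E X x y <= 0 /\ (x \notin X -> forall s c, (c, x) \in E ->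
    y \notin component E x c -> s \in X -> s \in component E x c ->
    ascent E X x y <= -1) by move=> x; case: (main x).
move: x; apply: (ind_towards tE (y := y)).
  by rewrite ascent_refl // yX.
move=> x z xz yz [IH1 IH2].
have zx : adjacent E z x by rewrite adjacentC.
have yx : y \notin component E z x by rewrite (componentC tE xz) in_setC yz.
rewrite (ascent_step _ tE xz yz); case: ifP => exz.
  split.
    case: (boolP (x \in X)) (boolP (z \in X)) => xX [] zX /=.
    - by rewrite subrr addr0.
    - by rewrite subr0 -lerBrDr sub0r; apply: (IH2 zX x x); rewrite ?component_self.
    - by rewrite sub0r subr_le0 (le_trans IH1) // ler01.
    - by rewrite subrr addr0.
  move=> xX s c cx yc sX sc; rewrite (negPf xX).
  case: (boolP (z \in X)) => zX /=; first by rewrite sub0r gerDr.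
  rewrite subrr addr0; apply: (IH2 zX s x) => //.
  rewrite (componentC tE xz) in_setC; apply/negP => sz.
  have xc : adjacent E x c by rewrite /adjacent /= cx orbT.
  by move: yc; rewrite (component_disjoint tE xc xz sc sz) yz.
have ezx : (z, x) \in E by move: xz; rewrite /adjacent /= exz.
rewrite addr0; split=> // xX s c cx yc sX sc.
have cNz : c != z by apply: contraNneq yc => ->.
have : dn x && ((c < x)%N != (z < x)%N).
  apply: contraNT cNz; rewrite negb_and negbK => h; apply/eqP.
  by apply: (child_unique pE cx ezx) => dx; move: h; rewrite dx => /eqP.
case/andP => dx; rewrite -(child_side pE dx cx sc) -(child_side pE dx ezx yz).
have sx : s != x by apply: contraTneq sX => ->.
have yNx : y != x by apply: contraTneq yX => ->.
move/val_neq in sx; move/val_neq in yNx => sy.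
case: (ltnP s x) sy => sx'; case: (ltnP y x) => yx' // _.
  by case: (cX x s y) => //; clear -yx' yNx; lia.
by case: (cX x y s) => //; clear -sx' sx; lia.
Qed.

(** If [y] is in [X], or if [x] is not, this is [ascent_le0] or its image under
    arrow reversal; the remaining case follows by exchanging [x] and [y]. *)
Lemma ascent_le dn up E X x y : ptree dn up E -> delta_convex dn up X ->
  ascent E X x y <= ((x \in X) && (y \notin X))%:R.
Proof.
move=> pE [dX uX]; case: (boolP (y \in X)) => yX.
  by rewrite andbF; apply: (ascent_le0 pE dX).
case: (boolP (x \in X)) => xX /=; last first.
  rewrite -ascent_reverse; apply: (ascent_le0 (ptree_reverse pE) uX).
  by rewrite in_setC.
have := ascentB X x y (ptree_tree pE); rewrite xX (negPf yX) /=.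
have := ascent_le0 pE dX xX y; lra.
Qed.

End Ascent.

End Ptrees.

(** * Flows through the edges *)

Section Slices.
Local Open Scope set_scope.
Local Open Scope ring_scope.
Variables (n : nat) (R : realDomainType).
Implicit Types (E : {set 'I_n * 'I_n}) (X : {set 'I_n}).
Implicit Types (dn up : pred 'I_n) (x y z p q i j k a b : 'I_n).

(** The number of pairs of vertices joined by a path that goes up through [e]. *)
Definition weight E (e : 'I_n * 'I_n) : R :=
  #|component E e.2 e.1|%:R * #|component E e.1 e.2|%:R.

Lemma card_indicator X : #|X|%:R = \sum_k (k \in X)%:R :> R.
Proof. by rewrite -sum1_card natr_sum [RHS]big_mkcond /= big_mkcond;
  apply: eq_bigr => k _; case: ifP. Qed.

Lemma sum_pair_indicator (X Y : {set 'I_n}) :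
  \sum_x \sum_y ((x \in X) && (y \in Y))%:R = #|X|%:R * #|Y|%:R :> R.
Proof.
rewrite !card_indicator mulr_suml; apply: eq_bigr => x _.
by rewrite mulr_sumr; apply: eq_bigr => y _; rewrite -natrM mulnb.
Qed.

Definition outflow E X : R :=
  \sum_(e in E) weight E e * ((e.1 \in X)%:R - (e.2 \in X)%:R).

Lemma sum_ascent E X : \sum_x \sum_y ascent R E X x y = outflow E X.
Proof.
rewrite /ascent; under eq_bigr => x _ do rewrite exchange_big.
rewrite exchange_big; apply: eq_bigr => e _ /=.
rewrite /weight -sum_pair_indicator mulr_suml; apply: eq_bigr => x _.
by rewrite mulr_suml.
Qed.

Lemma outflow_le dn up E X : ptree dn up E -> delta_convex dn up X ->
  outflow E X <= #|X|%:R * #|~: X|%:R.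
Proof.
move=> pE cX; rewrite -sum_ascent -sum_pair_indicator.
apply: ler_sum => x _; apply: ler_sum => y _; rewrite in_setC.
exact: ascent_le pE cX.
Qed.

(** Equality means equality for each pair of vertices. If an edge goes up from [a]
    outside [X] to [b] in [X], the pair [(a, b)] falls short. If there is none, all
    ascents are nonnegative, hence at least 1 for [x] in [X] and [y] outside, by
    comparison with the ascent from [y] to [x]. *)
Lemma outflow_eq dn up E X : ptree dn up E -> delta_convex dn up X ->
  outflow E X = #|X|%:R * #|~: X|%:R <-> down_closed E X.
Proof.
move=> pE cX; have tE := ptree_tree pE; split=> [eqX|dE].
  move=> a b ab bX; apply: contraT => aX.
  have: outflow E X < #|X|%:R * #|~: X|%:R.
    rewrite -sum_ascent -sum_pair_indicator.
    have le x y : ascent R E X x y <= ((x \in X) && (y \in ~: X))%:R.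
      by rewrite in_setC; apply: ascent_le pE cX.
    rewrite (bigD1 a) //= [ltRHS](bigD1 a) //=; apply: ltr_leD; last first.
      by apply: ler_sum => x _; apply: ler_sum => y _.
    rewrite (bigD1 b) //= [ltRHS](bigD1 b) //=; apply: ltr_leD; last first.
      by apply: ler_sum.
    have aab : adjacent E a b by rewrite /adjacent /= ab.
    rewrite (ascent_step R _ tE aab) ?component_self // ascent_refl // ab.
    by rewrite bX (negPf aX) /=; lra.
  by rewrite eqX ltxx.
apply: le_anti; rewrite (outflow_le pE cX) /=.
have ge0 x y : 0 <= ascent R E X x y.
  apply: sumr_ge0 => -[a b] /= ab; apply: mulr_ge0; rewrite ?ler0n //.
  rewrite subr_ge0 ler_nat; case: (boolP (b \in X)) => // bX.
  by rewrite (dE _ _ ab).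
rewrite -sum_ascent -sum_pair_indicator.
apply: ler_sum => x _; apply: ler_sum => y _.
case: (boolP ((x \in X) && (y \in ~: X))) => // /andP[xX]; rewrite in_setC => yX.
have := ascentB R X x y tE; rewrite xX (negPf yX) /=; have := ge0 y x; lra.
Qed.

Lemma card_neighbor_components E k (P : pred 'I_n) : directed_tree E ->
  (forall b, P b -> adjacent E k b) ->
  #|\bigcup_(b | P b) component E k b| = (\sum_(b | P b) #|component E k b|)%N.
Proof.
move=> tE adj; rewrite big_mkcond [RHS]big_mkcond /= -sum1_card.
rewrite partition_disjoint_bigcup => [|b c bc].
  by apply: eq_bigr => b _; rewrite sum1_card; case: ifP; rewrite ?cards0.
rewrite -setI_eq0; case: ifP => Pb; last by rewrite set0I.
case: ifP => Pc; last by rewrite setI0.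
apply: contra_neqT bc => /set0Pn[x /setIP[xb xc]].
exact: (component_disjoint tE (adj _ Pb) (adj _ Pc) xb xc).
Qed.

Lemma card_all_components E k : directed_tree E ->
  (1 + \sum_(b | (b, k) \in E) #|component E k b| +
   \sum_(a | (k, a) \in E) #|component E k a| = n)%N.
Proof.
move=> tE.
have -> : (\sum_(a | (k, a) \in E) #|component E k a| =
    \sum_(a | adjacent E k a && ((a, k) \notin E)) #|component E k a|)%N.
  apply: eq_bigl => a; rewrite /adjacent /=.
  by case ka: ((k, a) \in E); case ak: ((a, k) \in E) => //;
    move: (tree_antisym tE ka); rewrite ak.
have -> : (\sum_(b | (b, k) \in E) #|component E k b| =
    \sum_(b | adjacent E k b && ((b, k) \in E)) #|component E k b|)%N.
  by apply: eq_bigl => b; rewrite /adjacent /=; case: ((b, k) \in E);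
    rewrite ?andbF ?orbT.
rewrite -addnA -bigID -card_neighbor_components // add1n.
have -> : \bigcup_(b | adjacent E k b) component E k b = [set~ k].
  apply/setP => x; rewrite in_setC1; apply/bigcupP/idP => [[b kb]|xk].
    apply: contraTneq => ->.
    by rewrite component_notin // eq_sym (adjacent_neq tE kb).
  by rewrite eq_sym in xk; have [b kb xb] := component_neighbor tE xk; exists b.
by rewrite cardsC1 card_ord; case: n k => // -[].
Qed.

Lemma sum_at_most_one (P : pred 'I_n) (f : 'I_n -> R) :
  (forall b c, P b -> P c -> b = c) ->
  \sum_(b | P b) f b ^+ 2 = (\sum_(b | P b) f b) ^+ 2.
Proof.
move=> uP; case: (pickP P) => [b Pb|P0]; last by rewrite !big_pred0 ?expr0n.
have eP : P =1 pred1 b.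
  by move=> c; apply/idP/eqP => [Pc|-> //]; apply: uP.
by rewrite !(big_pred1 b).
Qed.

Lemma weight_into E k : directed_tree E ->
  \sum_(e in E) weight E e * (e.2 == k)%:R =
  \sum_(b | (b, k) \in E) #|component E k b|%:R * (n%:R - #|component E k b|%:R).
Proof.
move=> tE.
transitivity (\sum_(e in E | e.2 == k) weight E e).
  by rewrite [RHS]big_mkcondr; apply: eq_bigr => e _; case: eqP;
    rewrite ?mulr1 ?mulr0.
rewrite (reindex_onto (fun b => (b, k)) fst) => [|[a b] /= /andP[_ /eqP->] //].
apply: eq_big => [b|b] /=; rewrite !eqxx !andbT // => bk.
have akb : adjacent E k b by rewrite /adjacent /= bk orbT.
rewrite /weight /= (componentC tE akb) (cardsCs (~: component E k b)) setCK card_ord natrB //.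
by rewrite -[leqRHS]card_ord max_card.
Qed.

Lemma weight_from E k : directed_tree E ->
  \sum_(e in E) weight E e * (e.1 == k)%:R =
  \sum_(a | (k, a) \in E) #|component E k a|%:R * (n%:R - #|component E k a|%:R).
Proof.
move=> tE.
transitivity (\sum_(e in E | e.1 == k) weight E e).
  by rewrite [RHS]big_mkcondr; apply: eq_bigr => e _; case: eqP;
    rewrite ?mulr1 ?mulr0.
rewrite (reindex_onto (fun a => (k, a)) snd) => [|[a b] /= /andP[_ /eqP->] //].
apply: eq_big => [a|a] /=; rewrite !eqxx !andbT // => ka.
have aka : adjacent E k a by rewrite /adjacent /= ka.
rewrite /weight /= (componentC tE aka) (cardsCs (~: component E k a)) setCK card_ord natrB 1?mulrC //.
by rewrite -[leqRHS]card_ord max_card.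
Qed.

End Slices.

(** * The coordinates of the vertices as flows *)

Section ChildConditions.
Local Open Scope nat_scope.
Local Open Scope set_scope.
Variable n : nat.
Implicit Types (E : {set 'I_n * 'I_n}) (dn up : pred 'I_n) (i j k b : 'I_n).

Definition child_condition dn E i : bool :=
  if dn i then
    [&& #|[set j in children E i | j < i]| <= 1,
        #|[set j in children E i | i < j]| <= 1,
        [forall k in left_descendants E i, k < i]
      & [forall k in right_descendants E i, i < k]]
  else #|children E i| <= 1.

Lemma in_children E i b : (b \in children E i) = ((b, i) \in E).
Proof. by rewrite inE. Qed.

Lemma in_left_descendants E i b k : (b, i) \in E -> b < i ->
  k \in component E i b -> k \in left_descendants E i.
Proof. by move=> bi lt kb; apply/bigcupP; exists b; rewrite // in_children bi. Qed.

Lemma in_right_descendants E i b k : (b, i) \in E -> i < b ->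
  k \in component E i b -> k \in right_descendants E i.
Proof. by move=> bi lt kb; apply/bigcupP; exists b; rewrite // in_children bi. Qed.

Lemma child_conditionP dn E i : directed_tree E ->
  child_condition dn E i <->
  (forall b b', (b, i) \in E -> (b', i) \in E ->
    (dn i -> (b < i) = (b' < i)) -> b = b') /\
  (forall b k, dn i -> (b, i) \in E -> k \in component E i b ->
    (k < i) = (b < i)).
Proof.
move=> tE; have gtE b : (b, i) \in E -> (i < b) = ~~ (b < i).
  by move=> /(tree_neq tE)/val_neq; clear; lia.
rewrite /child_condition; case: (boolP (dn i)) => di; split.
- case/and4P => /card_le1_eqP u1 /card_le1_eqP u2 /forall_inP s1 /forall_inP s2.
  split=> [b b' bi b'i /(_ isT) e|b k _ bi kb].
    case: (boolP (b < i)) => lt.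
      by apply: u1; rewrite inE in_children ?bi ?b'i //= -e.
    by apply: u2; rewrite inE in_children gtE ?bi ?b'i //= -e.
  case: (boolP (b < i)) => lt; first exact/s1/(in_left_descendants bi lt).
  have /s2 : k \in right_descendants E i.
    by apply: in_right_descendants kb; rewrite ?gtE.
  by clear; lia.
- case=> cu cs; apply/and4P; split.
  + apply/card_le1_eqP => b b'; rewrite !inE => /andP[bi lt] /andP[b'i lt'].
    by apply: cu => // _; rewrite lt lt'.
  + apply/card_le1_eqP => b b'; rewrite !inE => /andP[bi lt] /andP[b'i lt'].
    by apply: cu => // _; move: lt lt'; clear; lia.
  + apply/forall_inP => k /bigcupP[b /andP[]]; rewrite in_children => bi lt kb.
    by rewrite (cs b).
  + apply/forall_inP => k /bigcupP[b /andP[]]; rewrite in_children => bi lt kb.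
    have kNi : k != i.
      apply: contraTneq kb => ->.
      by rewrite component_notin // (tree_neq tE).
    by move/val_neq: kNi (cs b k isT bi kb) lt; clear; lia.
- move=> /card_le1_eqP u; split=> // b b' bi b'i _.
  by apply: u; rewrite in_children.
- case=> cu _; apply/card_le1_eqP => b b'; rewrite !in_children => bi b'i.
  exact: cu.
Qed.

Lemma parents_reverse E i : parents E i = children (reverse E) i.
Proof. by apply/setP => b; rewrite !inE. Qed.

Lemma left_ancestors_reverse E i :
  left_ancestors E i = left_descendants (reverse E) i.
Proof.
rewrite /left_ancestors parents_reverse.
by apply: eq_bigr => b _; rewrite component_reverse.
Qed.

Lemma right_ancestors_reverse E i :
  right_ancestors E i = right_descendants (reverse E) i.
Proof.
rewrite /right_ancestors parents_reverse.
by apply: eq_bigr => b _; rewrite component_reverse.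
Qed.

Variable delta : n.-tuple deco.

Definition down i := two_children (tnth delta i).
Definition up i := two_parents (tnth delta i).

Lemma is_permutreeP E : is_permutree delta E <-> ptree down up E.
Proof.
have -> : is_permutree delta E = directed_tree E &&
    [forall i, child_condition up (reverse E) i && child_condition down E i].
  congr (_ && _); apply: eq_forallb => i; congr (_ && _).
  rewrite /child_condition /up left_ancestors_reverse right_ancestors_reverse.
  by rewrite parents_reverse.
split=> [/andP[tE /forallP h]|pE].
  have tE' := tree_reverse tE; split=> //.
  - move=> i; case/andP: (h i) => _ /(child_conditionP _ _ tE)[cu _]; exact: cu.
  - move=> i; case/andP: (h i) => _ /(child_conditionP _ _ tE)[_ cs]; exact: cs.
  - move=> i b b' ib ib'; case/andP: (h i) => /(child_conditionP _ _ tE')[cu _] _.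
    by apply: cu; rewrite in_reverse.
  - move=> i b k ui ib kb; case/andP: (h i) => /(child_conditionP _ _ tE')[_ cs] _.
    by apply: cs; rewrite ?in_reverse ?component_reverse.
have pE' := ptree_reverse pE; have tE := ptree_tree pE.
apply/andP; split=> //; apply/forallP => i; apply/andP; split.
  apply/(child_conditionP _ _ (ptree_tree pE')); split.
    exact: (child_unique pE').
  by move=> b k; apply: (child_side pE').
apply/(child_conditionP _ _ tE); split.
  exact: (child_unique pE).
by move=> b k; apply: (child_side pE).
Qed.

End ChildConditions.

Section Coordinates.
Local Open Scope set_scope.
Local Open Scope ring_scope.
Variable n : nat.

(** The sum of squares is what enters the flow into [k]: it is the square of the total
    size, up to the mixed term when there are two children. *)
Lemma descendants_squares (R : realDomainType) (dn up : pred 'I_n) E k :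
  ptree dn up E ->
  let d : R := #|descendants E k|%:R in
  let ld : R := #|left_descendants E k|%:R in
  let rd : R := #|right_descendants E k|%:R in
  \sum_(b | (b, k) \in E) (#|component E k b|%:R : R) = d /\
  \sum_(b | (b, k) \in E) (#|component E k b|%:R : R) ^+ 2 =
    d ^+ 2 - (if dn k then 2 * ld * rd else 0).
Proof.
move=> pE d ld rd; have tE := ptree_tree pE.
have adj b : (b, k) \in E -> adjacent E k b.
  by rewrite /adjacent /= => ->; rewrite orbT.
have dE : d = \sum_(b | (b, k) \in E) #|component E k b|%:R.
  rewrite -natr_sum -(card_neighbor_components tE adj); congr (_%:R).
  by congr #|pred_of_set _|; apply: eq_bigl => b; rewrite in_children.
split=> //; case: ifP => dk; last first.
  rewrite subr0 dE sum_at_most_one // => b c bk ck.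
  by apply: (child_unique pE bk ck); rewrite dk.
have ldE : ld = \sum_(b | ((b, k) \in E) && (b < k)%N) #|component E k b|%:R.
  rewrite -natr_sum -(card_neighbor_components tE) => [|b /andP[/adj]] //.
  by congr (#|pred_of_set _|%:R); apply: eq_bigl => b; rewrite in_children.
have rdE : rd = \sum_(b | ((b, k) \in E) && ~~ (b < k)%N) #|component E k b|%:R.
  rewrite -natr_sum -(card_neighbor_components tE) => [|b /andP[/adj]] //.
  congr (#|pred_of_set _|%:R); apply: eq_bigl => b; rewrite in_children.
  by case bk: ((b, k) \in E) => //=; have := val_neq (tree_neq tE bk); clear; lia.
have -> : d = ld + rd by rewrite dE ldE rdE -bigID.
rewrite (bigID (fun b : 'I_n => (b < k)%N)) /= !sum_at_most_one.
- by rewrite -ldE -rdE; ring.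
- move=> b c /andP[bk /negPf lb] /andP[ck /negPf lc].
  by apply: (child_unique pE bk ck); rewrite lb lc.
- move=> b c /andP[bk lb] /andP[ck lc].
  by apply: (child_unique pE bk ck); rewrite lb lc.
Qed.

Lemma ancestors_squares (R : realDomainType) (dn up : pred 'I_n) E k :
  ptree dn up E ->
  let p : R := \sum_(a | (k, a) \in E) #|component E k a|%:R in
  let la : R := #|left_ancestors E k|%:R in
  let ra : R := #|right_ancestors E k|%:R in
  \sum_(a | (k, a) \in E) (#|component E k a|%:R : R) ^+ 2 =
    p ^+ 2 - (if up k then 2 * la * ra else 0).
Proof.
move=> pE; rewrite left_ancestors_reverse right_ancestors_reverse /=.
have [dE dE2] := descendants_squares R k (ptree_reverse pE).
have -> : \sum_(a | (k, a) \in E) (#|component E k a|%:R : R) =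
    #|descendants (reverse E) k|%:R.
  by rewrite -dE; apply: eq_big => [a|a _]; rewrite ?in_reverse ?component_reverse.
by rewrite -dE2; apply: eq_big => [a|a _]; rewrite ?in_reverse ?component_reverse.
Qed.

Variables (R : realType) (delta : n.-tuple deco).
Implicit Types T S : permutree delta.

Lemma permutreeP T : ptree (down delta) (up delta) T.
Proof. by apply/is_permutreeP; case: T. Qed.

(** If [d] and [p] are the total sizes of the descendant and ancestor subtrees, then
    [n = 1 + d + p] and, apart from the mixed terms, the net flow into [k] is
    [d (n - d) - p (n - p) = d (p + 1) - p (d + 1) = d - p]. *)
Lemma permutree_point_flow T k :
  2 * permutree_point R T 0 k =
  n.+1%:R + \sum_(e in permutree_edges T)
    weight R T e * ((e.2 == k)%:R - (e.1 == k)%:R).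
Proof.
have pT := permutreeP T; have tT := ptree_tree pT.
under eq_bigr do rewrite mulrBr.
rewrite sumrB weight_into // weight_from //.
have [dE dE2] := descendants_squares R k pT.
have pE2 := ancestors_squares R k pT.
under eq_bigr do rewrite mulrBr -expr2 mulrC.
rewrite sumrB -mulr_sumr dE dE2.
under [X in _ - X]eq_bigr do rewrite mulrBr -expr2 mulrC.
rewrite sumrB -mulr_sumr pE2.
have nE := card_all_components k tT.
have {nE} nE : n%:R = 1 + #|descendants T k|%:R +
    \sum_(a | (k, a) \in permutree_edges T) #|component T k a|%:R :> R.
  by rewrite -dE -!natr_sum -[1]/(1%:R) -!natrD nE.
rewrite -[n.+1%:R]natr1 nE mxE /down /up.
by case: (tnth delta k) => /=; ring.
Qed.

Lemma permutree_point_sum T (X : {set 'I_n}) :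
  2 * \sum_(k in X) permutree_point R T 0 k =
  n.+1%:R * #|X|%:R - outflow R T X.
Proof.
rewrite mulr_sumr; under eq_bigr do rewrite permutree_point_flow.
rewrite big_split /= sumr_const -[_ *+ #|X|]mulr_natr; congr (_ + _).
rewrite exchange_big /= /outflow -sumrN; apply: eq_bigr => e _.
rewrite -mulr_sumr -mulrN opprB; congr (_ * _).
have ind (v : 'I_n) : \sum_(k in X) (v == k)%:R = (v \in X)%:R :> R.
  rewrite big_mkcond (bigD1 v) //= eqxx big1 ?addr0; first by case: ifP.
  by move=> k kv; rewrite eq_sym (negPf kv); case: ifP.
by rewrite sumrB !ind.
Qed.

End Coordinates.

(** * Trees are determined by the down-sets among cuts *)

Section Ascends.
Local Open Scope nat_scope.
Local Open Scope set_scope.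
Variable n : nat.
Implicit Types (E : {set 'I_n * 'I_n}) (X : {set 'I_n}).
Implicit Types (dn up : pred 'I_n) (x y z i j k a b : 'I_n).

Lemma ascends_down_closed E X x y :
  down_closed E X -> ascends E x y -> y \in X -> x \in X.
Proof.
move=> dX /connectP[s]; elim: s x => [|z s IH] x /= => [_ -> //|].
by case/andP => xz sz lst yX; apply: (dX _ _ xz); apply: IH lst yX.
Qed.

Lemma ascends_of_cuts E x y : directed_tree E ->
  (forall a b, (a, b) \in E -> y \in component E b a -> x \in component E b a) ->
  ascends E x y.
Proof.
move=> tE; move: x; apply: (ind_towards tE (y := y)) => [_|x z xz yz IH cuts].
  exact: connect0.
have exz : (x, z) \in E.
  case/orP: (xz) => // ezx.
  have := cuts _ _ ezx yz.
  by rewrite (negPf (component_notin _ _)) // eq_sym (adjacent_neq tE).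
apply: (connect_trans (connect1 (exz : [rel x y | (x, y) \in E] x z))).
apply: IH => a b ab yX; rewrite -(bridge_same (component_bridge tE ab) exz).
  exact: cuts.
apply: contraTneq yX => -[<- <-].
by rewrite (componentC tE xz) in_setC negbK.
Qed.

(** Edges are covers for the order defined by a directed tree: an edge incident
    to [z] separates [z] from both ends of the edge from [x] to [y]. *)
Lemma edge_cover E x y z : directed_tree E -> (x, y) \in E ->
  ascends E x z -> ascends E z y -> z = x \/ z = y.
Proof.
move=> tE xy xz zy; case: (eqVneq z x) => [->|zx]; first by left.
case: (eqVneq z y) => [->|zNy]; first by right.
have [w zw xw] := component_neighbor tE zx.
have axy : adjacent E x y by rewrite /adjacent /= xy.
have yw : y \in component E z w.
  by apply: (component_step axy) xw; rewrite eq_sym.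
have zN : z \notin component E z w.
  by rewrite component_notin // eq_sym (adjacent_neq tE).
case/orP: (zw) => ew.
  have dX := bridge_down_closed (component_bridge tE ew).
  have := ascends_down_closed dX xz (component_self _ _ _).
  by rewrite (componentC tE zw) in_setC xw.
have dX := bridge_down_closed (component_bridge tE ew).
by have := ascends_down_closed dX zy yw; rewrite (negPf zN).
Qed.

Lemma ascends_first E x y : x != y -> ascends E x y ->
  exists2 z, (x, z) \in E & ascends E z y.
Proof.
move=> xNy /connectP[[|z s]] /=; first by move=> _ e; rewrite e eqxx in xNy.
by case/andP => xz sz lst; exists z => //; apply/connectP; exists s.
Qed.

Lemma ascends_inj_sub E E' : directed_tree E -> directed_tree E' ->
  ascends E =2 ascends E' -> E \subset E'.
Proof.
move=> tE tE' eA; apply/subsetP => -[x y] xy.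
have xNy := tree_neq tE xy.
have : ascends E' x y by rewrite -eA; apply: connect1.
case/(ascends_first xNy) => z xz zy.
have := edge_cover tE xy; move/(_ z); rewrite !eA => /(_ (connect1 xz) zy)[e|<- //].
by move: (tree_irrefl tE' x); rewrite -{2}e xz.
Qed.

Lemma ascends_inj E E' : directed_tree E -> directed_tree E' ->
  ascends E =2 ascends E' -> E = E'.
Proof.
by move=> tE tE' eA; apply/eqP; rewrite eqEsubset !ascends_inj_sub //.
Qed.

Lemma ascends_of_edges E E' : directed_tree E' ->
  (forall a b, (a, b) \in E' -> down_closed E (component E' b a)) ->
  subrel (ascends E) (ascends E').
Proof.
move=> tE' dE; apply: connect_sub => x y /= xy.
by apply: ascends_of_cuts => // a b ab; apply: dE xy.
Qed.

Lemma tree_of_cuts E E' : directed_tree E -> directed_tree E' ->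
  (forall a b, (a, b) \in E' -> down_closed E (component E' b a)) ->
  (forall a b, (a, b) \in E -> down_closed E' (component E b a)) ->
  E = E'.
Proof.
move=> tE tE' d d'; apply: ascends_inj => // x y.
by apply/idP/idP; apply: ascends_of_edges.
Qed.

End Ascends.

(** * Maximizing linear forms over the points of permutrees *)

Section Geometry.
Local Open Scope set_scope.
Local Open Scope ring_scope.
Variables (R : realType) (n : nat) (delta : n.-tuple deco).
Implicit Types (T S : permutree delta) (c v : 'rV[R]_n).
Local Notation a := (@permutree_point R n delta).
Local Notation cut T e := (component (permutree_edges T) e.2 e.1).

Lemma permutree_tree T : directed_tree T.
Proof. exact: ptree_tree (permutreeP T). Qed.

Definition mass (X : {set 'I_n}) v : R := \sum_(k in X) v 0 k.

Lemma massB X v w : mass X (v - w) = mass X v - mass X w.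
Proof. by rewrite /mass -sumrB; apply: eq_bigr => k _; rewrite !mxE. Qed.

Lemma innerBr c v w : inner c (v - w) = inner c v - inner c w.
Proof. by rewrite /inner -sumrB; apply: eq_bigr => k _; rewrite !mxE mulrBr. Qed.

Lemma mass_permutree_point T X :
  2 * mass X (a T) = n.+1%:R * #|X|%:R - outflow R T X.
Proof. exact: permutree_point_sum. Qed.

Lemma mass_total T S : mass setT (a S - a T) = 0.
Proof.
have out U : outflow R (permutree_edges U) setT = 0.
  by move=> *; apply: big1 => e _; rewrite !inE subrr mulr0.
apply/eqP; rewrite massB subr_eq0; apply/eqP.
apply: (@mulfI _ (2 : R)); first by rewrite pnatr_eq0.
by rewrite !mass_permutree_point !out.
Qed.

Lemma mass_cut_ge0 T S e : e \in permutree_edges T ->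
  0 <= mass (cut T e) (a S - a T).
Proof.
case: e => x y xy; have cX := cut_delta_convex (permutreeP T) xy.
have dX := bridge_down_closed (component_bridge (permutree_tree T) xy).
have := outflow_le R (permutreeP S) cX.
have [_ /(_ dX)] := outflow_eq R (permutreeP T) cX.
rewrite massB /=; have := mass_permutree_point T (component T y x).
have := mass_permutree_point S (component T y x); lra.
Qed.

Lemma mass_cut_eq0 T S e : e \in permutree_edges T ->
  mass (cut T e) (a S - a T) = 0 <-> down_closed S (cut T e).
Proof.
case: e => x y xy; have cX := cut_delta_convex (permutreeP T) xy.
have dX := bridge_down_closed (component_bridge (permutree_tree T) xy).
have [_ /(_ dX) eT] := outflow_eq R (permutreeP T) cX.
rewrite -(outflow_eq R (permutreeP S) cX) massB /=.
have := mass_permutree_point T (component T y x).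
have := mass_permutree_point S (component T y x).
by split; lra.
Qed.

(** Summation by parts along the edges of [T]. *)
Lemma inner_cuts T c v : mass setT v = 0 ->
  inner c v = \sum_(e in permutree_edges T)
    (c 0 e.1 - c 0 e.2) * mass (cut T e) v.
Proof.
move=> v0; case: (pickP 'I_n) => [y _|none]; last first.
  by rewrite /inner !big1 // => [[x y] _|k _]; [move: (none x) | move: (none k)].
transitivity (\sum_k (c 0 k - c 0 y) * v 0 k).
  under [RHS]eq_bigr do rewrite mulrBl.
  rewrite sumrB -mulr_sumr.
  suff -> : \sum_k v 0 k = 0 by rewrite mulr0 subr0.
  by rewrite -[RHS]v0; apply: eq_bigl => k; rewrite inE.
under eq_bigr => k _ do
  rewrite (cut_decomposition (fun k => c 0 k) _ _ (permutree_tree T)) mulr_suml.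
rewrite exchange_big; apply: eq_bigr => e _ /=.
under eq_bigr do rewrite -mulrA.
rewrite -mulr_sumr; congr (_ * _).
under eq_bigr do rewrite mulrBl.
rewrite sumrB -mulr_sumr.
have -> : \sum_k v 0 k = 0.
  by rewrite -[RHS]v0; apply: eq_bigl => k; rewrite inE.
rewrite mulr0 subr0 /mass [RHS]big_mkcond; apply: eq_bigr => k _.
by case: ifP; rewrite ?mul1r ?mul0r.
Qed.

Lemma inner_diff T S c : inner c (a S) - inner c (a T) =
  \sum_(e in permutree_edges T)
    (c 0 e.1 - c 0 e.2) * mass (cut T e) (a S - a T).
Proof. by rewrite -innerBr; apply/inner_cuts/mass_total. Qed.

Definition increasing_on T c : Prop :=
  forall e, e \in permutree_edges T -> c 0 e.1 <= c 0 e.2.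

Lemma increasing_on_max T c S : increasing_on T c ->
  inner c (a S) <= inner c (a T).
Proof.
move=> incr; rewrite -subr_le0 inner_diff; apply: sumr_le0 => e eT.
by rewrite mulr_le0_ge0 ?subr_le0 ?incr // mass_cut_ge0.
Qed.

Lemma increasing_on_max_cuts T c S : increasing_on T c ->
  inner c (a S) = inner c (a T) ->
  forall e, e \in permutree_edges T -> c 0 e.1 < c 0 e.2 ->
  down_closed S (cut T e).
Proof.
move=> incr /eqP; rewrite -subr_eq0 inner_diff -oppr_eq0 -sumrN.
rewrite psumr_eq0 => [/allP h e eT lt|e eT]; last first.
  by rewrite oppr_ge0 mulr_le0_ge0 ?subr_le0 ?incr // mass_cut_ge0.
apply/mass_cut_eq0 => //.
move: (h e); rewrite mem_index_enum eT oppr_eq0 mulf_eq0 subr_eq0 => /(_ isT).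
by rewrite lt_eqF //= => /eqP.
Qed.

(** A linear form that jumps by 1 along the selected edges of [T] and is constant
    along the others. *)
Definition jump_form T (P : pred ('I_n * 'I_n)) : 'rV[R]_n :=
  \row_k \sum_(e in permutree_edges T | P e) (k \notin cut T e)%:R.

Lemma jump_formE T P e : e \in permutree_edges T ->
  jump_form T P 0 e.2 = jump_form T P 0 e.1 + (P e)%:R.
Proof.
case: e => x y xy /=; have tT := permutree_tree T.
rewrite !mxE !big_mkcondr (bigD1 (x, y)) //= [in RHS](bigD1 (x, y)) //=.
rewrite component_self component_notin ?(tree_neq tT) //=.
rewrite addrAC; congr (_ + _); first by case: ifP; rewrite ?addr0 ?add0r.
apply: eq_bigr => -[p q] /= /andP[pq ne]; case: ifP => // _.
by rewrite (bridge_same (component_bridge tT pq) xy) // eq_sym.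
Qed.

Lemma jump_form_increasing T P : increasing_on T (jump_form T P).
Proof. by move=> e eT; rewrite jump_formE // lerDl ler0n. Qed.

Lemma jump_form_cuts T P S :
  inner (jump_form T P) (a S) = inner (jump_form T P) (a T) ->
  forall e, e \in permutree_edges T -> P e -> down_closed S (cut T e).
Proof.
move=> eqi e eT Pe.
apply: (increasing_on_max_cuts (@jump_form_increasing T P) eqi) => //.
by rewrite jump_formE // Pe ltrDl ltr01.
Qed.

(** If the cuts of [T] are down-sets of [S], the two points agree on all linear forms.
    Hence the form exposing [S] is also maximal at [T], and the cuts of [S] are
    down-sets of [T] in turn. *)
Lemma permutree_of_cuts T S :
  (forall e, e \in permutree_edges T -> down_closed S (cut T e)) -> S = T.
Proof.
move=> dS; apply/val_inj/tree_of_cuts; try exact: permutree_tree.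
  by move=> x y xy; apply: (dS (x, y)).
move=> x y xy; apply: (@jump_form_cuts S predT T _ (x, y)) => //.
apply/eqP; rewrite eq_sym -subr_eq0 inner_diff big1 // => e eT.
by rewrite (iffRL (mass_cut_eq0 _ eT) (dS e eT)) mulr0.
Qed.

(** Each permutree is the only maximizer of a linear form that increases along
    its edges. *)
Definition exposing_form T : 'rV[R]_n := jump_form T predT.

Lemma exposing_form_lt T S : S != T ->
  inner (exposing_form T) (a S) < inner (exposing_form T) (a T).
Proof.
move=> ST; rewrite lt_neqAle increasing_on_max ?andbT; last first.
  exact: jump_form_increasing.
apply: contraNneq ST => eqi; apply/eqP/permutree_of_cuts => e eT.
exact: jump_form_cuts eqi e eT isT.
Qed.

Lemma permutree_point_inj : injective a.
Proof.
move=> T S eTS; apply/eqP; apply: contraT => /exposing_form_lt.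
by rewrite eTS ltxx.
Qed.

Lemma inner_one_cut T S e : e \in permutree_edges T ->
  (forall f, f \in permutree_edges T -> f != e -> down_closed S (cut T f)) ->
  forall c, inner c (a S) - inner c (a T) =
    (c 0 e.1 - c 0 e.2) * mass (cut T e) (a S - a T).
Proof.
move=> eT dS c; rewrite inner_diff (bigD1 e) //= big1 ?addr0 // => f /andP[fT fe].
by rewrite (iffRL (mass_cut_eq0 _ fT) (dS f fT fe)) mulr0.
Qed.

Section RotatedPermutree.
Variables (T : permutree delta) (i j : 'I_n).
Hypothesis ij : (i, j) \in permutree_edges T.

Definition rotated : permutree delta :=
  Permutree (iffRL (is_permutreeP delta _) (rotation_ptree (permutreeP T) ij)).

Lemma rotated_cut f : f \in permutree_edges T -> f != (i, j) ->
  down_closed rotated (cut T f).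
Proof. by case: f => x y; exact: (rotation_cut_down_closed (permutreeP T) ij). Qed.

(** The cut of [i -> j] is not a down-set of the rotation, where the arrow is reversed;
    all other cuts remain down-sets. This determines the move from [a(T)] up to the
    positive factor below. *)
Definition rotated_shift : R := mass (cut T (i, j)) (a rotated - a T).

Lemma rotated_shift_gt0 : 0 < rotated_shift.
Proof.
rewrite lt_neqAle mass_cut_ge0 // andbT eq_sym; apply/eqP.
move/(mass_cut_eq0 _ ij) => dX; have tT := permutree_tree T.
have := dX j i (rotation_flip _ _ _ _ _) (component_self _ _ _).
by rewrite (negPf (component_notin _ _)) // (tree_neq tT).
Qed.

Lemma inner_rotated c : inner c (a rotated) - inner c (a T) =
  (c 0 i - c 0 j) * rotated_shift.
Proof. exact: (inner_one_cut ij rotated_cut). Qed.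

(** Three permutrees on the line through [T] in direction [e_i - e_j] cannot be
    distinct, since each of them is an extreme point. *)
Lemma one_cut_rotated S :
  (forall f, f \in permutree_edges T -> f != (i, j) -> down_closed S (cut T f)) ->
  S = T \/ S = rotated.
Proof.
move=> dS; have inS := inner_one_cut ij dS.
case: (eqVneq S T) => [->|ST]; [by left | right].
apply/eqP; apply: contraT => SR.
have TR : T != rotated.
  apply/eqP => e; have := rotated_shift_gt0.
  by rewrite /rotated_shift -e subrr /mass big1 ?ltxx // => k _; rewrite mxE.
have r0 := rotated_shift_gt0.
have s0 : 0 < mass (cut T (i, j)) (a S - a T).
  rewrite lt_neqAle mass_cut_ge0 // andbT eq_sym; apply/negP => /eqP s0.
  by move: (exposing_form_lt ST); rewrite -subr_lt0 inS s0 mulr0 ltxx.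
have RS : rotated != S by rewrite eq_sym.
have TS : T != S by rewrite eq_sym.
have h1 := exposing_form_lt SR; have h2 := exposing_form_lt RS.
have h3 := exposing_form_lt TS; have h4 := exposing_form_lt TR.
have e1 := inS (exposing_form S); have e2 := inner_rotated (exposing_form S).
have e3 := inS (exposing_form rotated);
  have e4 := inner_rotated (exposing_form rotated).
case: (ltgtP (mass (cut T (i, j)) (a S - a T)) rotated_shift) => [lt|gt|eqm].
- have d0 : 0 < exposing_form S 0 i - exposing_form S 0 j.
    by rewrite -(pmulr_lgt0 _ s0) -e1 subr_gt0.
  have := ler_wpM2l (ltW d0) (ltW lt); rewrite -e1 -e2 lerD2r leNgt.
  by rewrite h2.
- have d0 : 0 < exposing_form rotated 0 i - exposing_form rotated 0 j.
    by rewrite -(pmulr_lgt0 _ r0) -e4 subr_gt0.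
  have := ler_wpM2l (ltW d0) (ltW gt); rewrite -e3 -e4 lerD2r leNgt.
  by rewrite h1.
move: h1; rewrite -(ltrD2r (- inner (exposing_form rotated) (a T))) e3 e4 eqm.
by rewrite ltxx.
Qed.

End RotatedPermutree.
End Geometry.

(** * The rotation order *)

Section RotationOrder.
Local Open Scope nat_scope.
Local Open Scope set_scope.
Variables (n : nat) (delta : n.-tuple deco).
Implicit Types (T S : permutree delta) (i j k l x y : 'I_n).

Lemma rotate_rotation T i j : (i, j) \in permutree_edges T -> i < j ->
  rotate delta T i j = rotation (down delta) (up delta) T i j.
Proof.
move=> ij lt; have tT := permutree_tree T; rewrite /rotate /rotation.
have -> : [set b in children T i | two_children (tnth delta i) ==> (i < b)] =
    moved_children (down delta) T i j.
  apply/setP => b; rewrite !inE; case bi: ((b, i) \in _) => //=.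
  congr (_ ==> _); have /val_neq := tree_neq tT bi.
  by move: lt; clear; case: (ltngtP j i); case: (ltngtP b i).
have -> // : [set a in parents T j | two_parents (tnth delta j) ==> (a < j)] =
    moved_parents (up delta) T i j.
by apply/setP => b; rewrite !inE lt eqb_id.
Qed.

Lemma increasing_rotationP T S : increasing_rotation T S <->
  exists i j (ij : (i, j) \in permutree_edges T), i < j /\ S = rotated ij.
Proof.
split=> [/existsP[i /existsP[j /and3P[ij lt /eqP e]]]|[i [j [ij [lt ->]]]]].
  exists i, j, ij; split=> //; apply/val_inj => /=.
  by rewrite -rotate_rotation.
apply/existsP; exists i; apply/existsP; exists j.
by rewrite ij lt /= rotate_rotation.
Qed.

Lemma rotated_lost T i j (ij : (i, j) \in permutree_edges T) :
  ~~ ascends (rotated ij) i j.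
Proof.
have br := bridge_flip (permutreeP T) ij; have [jX iX _] := br.
apply/negP => up; move: iX.
by rewrite (ascends_down_closed (bridge_down_closed br) up jX).
Qed.

(** An increasing rotation creates no new relation [x] below [y] with [x < y]:
    such a relation would go up through the reversed edge, hence from the side
    of [j] to the side of [i] of the edge, and this is only possible for
    [j <= x] and [y <= i]. *)
Lemma rotated_ascends T i j (ij : (i, j) \in permutree_edges T) x y :
  i < j -> x < y -> ascends (rotated ij) x y -> ascends T x y.
Proof.
move=> lt xy asc; have pT := permutreeP T; have tT := permutree_tree T.
apply: ascends_of_cuts => // a b ab yX.
case: (eqVneq (a, b) (i, j)) => [[ea eb]|ne]; last first.
  exact: (ascends_down_closed (rotated_cut (ij := ij) ab ne) asc yX).
subst a b; apply: contraT => xX.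
have xj : x \in component T i j.
  by rewrite (componentC tT (adjji ij)) in_setC xX.
have pT' := ptree_reverse pT.
have ji : (j, i) \in reverse T by rewrite in_reverse.
have xA p : p \in moved_parents (up delta) T i j -> x \notin component T j p.
  move=> pA; have jp := moved_parent_edge pA; apply/negP => xp.
  have jNp := tree_neq tT jp; have ajp := moved_parent_adj pA.
  have yp : y \in component T p j.
    rewrite (componentC tT ajp) in_setC; apply/negP => yp.
    have := component_disjoint tT (adjji ij) ajp yX yp => e.
    by move: (moved_parent_neq pT ij pA); rewrite e eqxx.
  have ne : (j, p) != (i, j) by apply: contraNneq jNp => -[_ ->].
  have := ascends_down_closed (rotated_cut (ij := ij) jp ne) asc yp.
  by rewrite (componentC tT ajp) in_setC xp.
have yB p : p \in moved_children (down delta) T i j -> y \notin component T i p.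
  move=> pB; have pi := moved_child_edge pB; apply/negP => yp.
  have aip := moved_child_adj pB.
  have ne : (p, i) != (i, j).
    by apply: contraNneq (tree_irrefl tT i) => -[e _]; rewrite -{1}e.
  have xp := ascends_down_closed (rotated_cut (ij := ij) pi ne) asc yp.
  have := component_disjoint tT aip (adjij ij) xp xj => e.
  by move: (moved_child_neq pT ij pB); rewrite e eqxx.
have yi : y \in component (reverse T) j i by rewrite component_reverse.
have hx : j <= x.
  case: (beyond_flip pT ij xj xA) => [<- //|].
  by rewrite lt; case: ltnP.
have hy : y <= i.
  case: (beyond_flip pT' ji yi) => [p|<- //|].
    rewrite moved_parents_reverse component_reverse; exact: yB.
  by move: lt; case: (ltngtP j i); case: (ltngtP y i).
by move: xy lt hx hy; clear; lia.
Qed.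

Lemma permutree_le_ascends T S x y : permutree_le T S -> x < y ->
  ascends S x y -> ascends T x y.
Proof.
case/connectP => s; elim: s T => [|U s IH] T /= => [_ -> //|].
case/andP => /increasing_rotationP[i [j [ij [lt eU]]]] sU lst xy asc.
by apply: (rotated_ascends (ij := ij) lt xy); rewrite -eU; apply: IH.
Qed.

Lemma permutree_le_first T S : T != S -> permutree_le T S ->
  exists2 U, increasing_rotation T U & permutree_le U S.
Proof.
move=> TS /connectP[[|U s]] /=; first by move=> _ e; rewrite e eqxx in TS.
by case/andP => TU sU lst; exists U => //; apply/connectP; exists s.
Qed.

Lemma rotation_not_ge T S : increasing_rotation T S -> ~~ permutree_le S T.
Proof.
case/increasing_rotationP => i [j [ij [lt ->]]]; apply/negP => le.
move: (rotated_lost ij); apply/negP; rewrite negbK.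
by apply: (permutree_le_ascends le lt); apply: connect1.
Qed.

Lemma permutree_le_anti T S : permutree_le T S -> permutree_le S T -> T = S.
Proof.
move=> TS ST; apply/eqP; apply: contraT => ne.
have [U TU US] := permutree_le_first ne TS.
by move/negP: (rotation_not_ge TU); case; apply: connect_trans US ST.
Qed.

(** If [T] could be rotated to a permutree below [S] along another edge
    from [k] to [l], then [k] would still be below [l] in [S], although the
    rotation of this edge destroys this relation once and for all. *)
Lemma permutree_hasseP T S : permutree_hasse T S <-> increasing_rotation T S.
Proof.
split=> [/and3P[ne le /forallP cover]|TS].
  have [U TU US] := permutree_le_first ne le.
  have := implyP (cover U);
    rewrite US andbT /permutree_le (connect1 TU) => /(_ isT).
  case/orP => /eqP eU; last by rewrite -eU.
  by have := rotation_not_ge TU; rewrite eU /permutree_le connect0.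
have neTS : T != S.
  by apply: contraTneq (rotation_not_ge TS) => ->;
    rewrite negbK /permutree_le connect0.
apply/and3P; split=> //; first exact: connect1.
apply/forallP => U; apply/implyP => /andP[TU US].
case: (eqVneq U T) => //= neU; rewrite eq_sym in neU.
have [V TV VU] := permutree_le_first neU TU.
have [i [j [ij [lt eS]]]] := iffLR (increasing_rotationP T S) TS.
have [k [l [kl [lt' eV]]]] := iffLR (increasing_rotationP T V) TV.
suff eVS : V = S.
  by apply/eqP/permutree_le_anti => //; rewrite -eVS.
case: (eqVneq (k, l) (i, j)) => [[ek el]|ne].
  by subst k l; rewrite eV eS; apply: val_inj.
have VS : permutree_le V S := connect_trans VU US.
have kl_S : ascends S k l.
  by rewrite eS; apply: rotation_kept_ascends.
by have := permutree_le_ascends VS lt' kl_S; rewrite eV (negPf (rotated_lost kl)).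
Qed.

End RotationOrder.

(* From here on, the notations for sets are those for sets of points. *)
From mathcomp Require Import boolp classical_sets convex interval_inference.

(** * Faces of convex hulls *)

Section Polytope.
Local Open Scope classical_set_scope.
Local Open Scope ring_scope.
Variables (R : realType) (n : nat).
Implicit Types (P F C K S : set 'rV[R]_n) (p q c x y v w : 'rV[R]_n) (t M : R).

Lemma inner_comb c x y t :
  inner c (t *: x + (1 - t) *: y) = t * inner c x + (1 - t) * inner c y.
Proof.
rewrite /inner !mulr_sumr -big_split; apply: eq_bigr => k _ /=.
by rewrite !mxE; ring.
Qed.

Lemma innerN c x : inner (- c) x = - inner c x.
Proof. by rewrite /inner -sumrN; apply: eq_bigr => k _; rewrite mxE mulNr. Qed.

Lemma convex_setP K : @convex_set R 'rV[R]_n K <->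
  forall x y t, 0 < t -> t < 1 -> K x -> K y -> K (t *: x + (1 - t) *: y).
Proof.
rewrite convex_setW; split=> [cK x y t t0 t1 Kx Ky|cK x y].
  have t01 : (0 <= t <= 1) by rewrite !ltW.
  have := cK x y; rewrite !inE => /(_ Kx Ky (Itv01 (ltW t0) (ltW t1)) t0 t1).
  by rewrite inE.
by rewrite !inE => Kx Ky t t0 t1; rewrite inE; apply: (cK x y t%:num).
Qed.

Lemma convex_hull_sub S K : @convex_set R 'rV[R]_n K -> S `<=` K ->
  convex_hull S `<=` K.
Proof. exact: smallest_sub. Qed.

Lemma convex_hull_gen S : S `<=` convex_hull S.
Proof. exact: sub_gen_smallest. Qed.

Lemma convex_hull_convex S : @convex_set R 'rV[R]_n (convex_hull S).
Proof.
apply/convex_setP => x y t t0 t1 Sx Sy K [cK SK].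
by move/convex_setP: (cK); apply => //; [apply: Sx | apply: Sy].
Qed.

Lemma halfspace_convex c M : @convex_set R 'rV[R]_n [set x | inner c x <= M].
Proof.
apply/convex_setP => x y t t0 t1 /= hx hy; rewrite inner_comb.
have := ler_wpM2l (ltW t0) hx; have : 0 <= 1 - t by rewrite subr_ge0 ltW.
by move=> t1'; have := ler_wpM2l t1' hy; lra.
Qed.

Lemma convex_hull_le S c M : (forall x, S x -> inner c x <= M) ->
  forall x, convex_hull S x -> inner c x <= M.
Proof. by move=> le; apply: convex_hull_sub => //; apply: halfspace_convex. Qed.

(** The maximal points of a linear form over a convex hull lie in any convex set
    containing the maximal generators, since adding the points below the maximum
    to this set leaves it convex. *)
Lemma convex_hull_max S C c M : @convex_set R 'rV[R]_n C ->
  (forall x, C x -> inner c x <= M) ->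
  (forall x, S x -> inner c x < M \/ C x) ->
  forall x, convex_hull S x -> inner c x < M \/ C x.
Proof.
move=> cC leC SC; apply: convex_hull_sub => //.
apply/convex_setP => x y t t0 t1 hx hy /=.
have t1' : 0 < 1 - t by rewrite subr_gt0.
have le z : inner c z < M \/ C z -> inner c z <= M by case=> [/ltW|/leC].
rewrite inner_comb; case: hx (le _ hx) => [lx _|Cx lex].
  left; have h1 : t * inner c x < t * M by rewrite ltr_pM2l.
  have h2 : (1 - t) * inner c y <= (1 - t) * M by rewrite ler_pM2l // le.
  lra.
case: hy => [ly|Cy]; last by right; move/convex_setP: cC; apply.
left; have h1 : t * inner c x <= t * M by rewrite ler_pM2l.
have h2 : (1 - t) * inner c y < (1 - t) * M by rewrite ltr_pM2l.
lra.
Qed.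

Lemma face_of_max S C c M : @convex_set R 'rV[R]_n C -> C !=set0 ->
  C `<=` convex_hull S -> (forall x, C x -> inner c x = M) ->
  (forall x, S x -> inner c x < M \/ C x) -> face (convex_hull S) C.
Proof.
move=> cC [x0 Cx0] CS eqC SC; split; first by exists x0.
have leC x : C x -> inner c x <= M by move/eqC->.
have hull x : convex_hull S x -> inner c x < M \/ C x.
  exact: convex_hull_max.
exists c; apply/seteqP; split=> [x Cx|x [Sx maxx]].
  split=> [|y /hull[/ltW|/eqC ->]]; [exact: CS| |]; by rewrite (eqC x).
case: (hull _ Sx) => // lt.
by have := maxx _ (CS _ Cx0); rewrite (eqC _ Cx0) leNgt lt.
Qed.

Lemma face_generator S F : face (convex_hull S) F -> exists2 x, S x & F x.
Proof.
case=> -[x0 Fx0] [c eF]; move: Fx0; rewrite eF => -[Sx0 max0].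
apply: contrapT => none.
have : inner c x0 < inner c x0 \/ (set0 : set 'rV[R]_n) x0.
  apply: (convex_hull_max (S := S)) => //.
  move=> x Sx; left; rewrite ltNge; apply/negP => le; apply: none.
  exists x => //; split; first exact: convex_hull_gen.
  by move=> y /max0 ley; apply: le_trans ley le.
by case; rewrite ?ltxx.
Qed.

Lemma inner_self_gt0 v : v <> 0 -> 0 < inner v v.
Proof.
move=> v0; rewrite lt_neqAle sumr_ge0 ?andbT => [|k _];
  last by rewrite -expr2 sqr_ge0.
apply/eqP => e; apply: v0; apply/rowP => k; rewrite mxE; apply/eqP.
have /eqP := esym e; rewrite psumr_eq0 => [/allP /(_ k)|l _];
  last by rewrite -expr2 sqr_ge0.
by rewrite mem_index_enum mulf_eq0 orbb; apply.
Qed.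

(** An endpoint of a face that is a segment is extreme: otherwise removing it
    would leave a convex set containing all generators. *)
Lemma edge_endpoint S p q : polytope_edge (convex_hull S) p q -> S p.
Proof.
case=> pq [_ [c eF]]; apply: contrapT => Sp.
have Fp : convex_hull [set p; q] p by apply: convex_hull_gen; left.
move: (Fp); rewrite eF => -[Pp maxp].
suff: (convex_hull S `\ p) p by case=> _; apply.
move: {Fp} p Pp maxp Sp pq eF => p Pp maxp Sp pq eF.
apply: (convex_hull_sub (K := convex_hull S `\ p) _ _ Pp); last first.
  by move=> x Sx; split=> [|e]; [exact: convex_hull_gen | apply: Sp; rewrite -e].
apply/convex_setP => x y t t0 t1 [Sx xp] [Sy yp]; split.
  by move/convex_setP: (@convex_hull_convex S); apply.
move=> /= ep; have t1' : 0 < 1 - t by rewrite subr_gt0.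
have cp := inner_comb c x y t; rewrite ep in cp.
(* A maximum of [c] inside a segment is attained at its ends as well. *)
have max2 z w (s : R) : 0 < s -> 0 < 1 - s -> convex_hull S z -> convex_hull S w ->
    p = s *: z + (1 - s) *: w -> z <> p -> convex_hull [set p; q] z.
  move=> s0 s1 Sz Sw epz zp; rewrite eF; split=> // v /maxp lev.
  apply: le_trans lev _; rewrite leNgt; apply/negP => lt.
  have := inner_comb c z w s; rewrite -epz => e.
  have h1 : s * inner c z < s * inner c p by rewrite ltr_pM2l.
  have h2 : (1 - s) * inner c w <= (1 - s) * inner c p by rewrite ler_pM2l // maxp.
  by move: e h1 h2; clear; lra.
(* The form [p - q] singles out [p] on the segment from [p] to [q]. *)
have lt_d z : convex_hull [set p; q] z -> z <> p ->
    inner (p - q) z < inner (p - q) p.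
  move=> Fz zp.
  have : inner (p - q) z < inner (p - q) p \/ [set p] z.
    apply: (convex_hull_max (S := [set p; q])) => //.
    - by apply/convex_setP => u v s _ _ /= -> ->;
      rewrite -scalerDl addrC subrK scale1r.
    - by move=> u /= ->.
    - move=> u [->|->]; [by right | left].
      rewrite -subr_gt0 -innerBr; apply: inner_self_gt0.
      by move/eqP; rewrite subr_eq0 => /eqP.
  by case.
have hx := lt_d x (max2 _ _ _ t0 t1' Sx Sy (esym ep) xp) xp.
have ep' : p = (1 - t) *: y + (1 - (1 - t)) *: x by rewrite subKr addrC.
have t0' : 0 < 1 - (1 - t) by rewrite subKr.
have hy := lt_d y (max2 _ _ _ t1' t0' Sy Sx ep' yp) yp.
have := inner_comb (p - q) x y t; rewrite ep.
have h1 : t * inner (p - q) x < t * inner (p - q) p by rewrite ltr_pM2l.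
have h2 : (1 - t) * inner (p - q) y < (1 - t) * inner (p - q) p by rewrite ltr_pM2l.
by move: h1 h2; clear; lra.
Qed.

Lemma polytope_edgeC P p q : polytope_edge P p q -> polytope_edge P q p.
Proof. by case=> pq; rewrite setUC; split=> // e; apply: pq. Qed.

End Polytope.

(** * The skeleton of the permutreehedron *)

Section Skeleton.
Local Open Scope classical_set_scope.
Local Open Scope ring_scope.
Variables (R : realType) (n : nat) (delta : n.-tuple deco).
Implicit Types (T S U : permutree delta) (c p q : 'rV[R]_n) (i j : 'I_n).
Local Notation a := (@permutree_point R n delta).
Local Notation PT := (permutreehedron R delta).

Lemma permutree_point_vertex T : polytope_vertex PT (a T).
Proof.
apply: (face_of_max (c := exposing_form R T) (M := inner (exposing_form R T) (a T))).
- by apply/convex_setP => u v s _ _ /= -> ->; rewrite -scalerDl addrC subrK scale1r.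
- by exists (a T).
- by move=> x /= ->; apply: convex_hull_gen; exists T.
- by move=> x /= ->.
move=> x [S _ <-]; case: (eqVneq S T) => [->|ST]; [by right | left].
exact: exposing_form_lt.
Qed.

Lemma vertex_permutree_point p : polytope_vertex PT p -> exists T, p = a T.
Proof. by case/face_generator => x [T _ <-] /= e; exists T. Qed.

Lemma edge_permutree_points p q : polytope_edge PT p q ->
  exists T S, p = a T /\ q = a S.
Proof.
move=> pq; have [T _ <-] := edge_endpoint pq.
by have [S _ <-] := edge_endpoint (polytope_edgeC pq); exists T, S.
Qed.

(** The form [c] defining the edge is maximal at [T], so that, compared with the
    rotations of [T], it increases along all edges of [T], and it cannot increase
    strictly along all of them. The rotation of an edge where it is constant
    yields another vertex of the segment. *)
Lemma edge_rotated T S : polytope_edge PT (a T) (a S) ->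
  exists i j (ij : (i, j) \in permutree_edges T), S = rotated ij.
Proof.
case=> TS [_ [c eF]].
have : convex_hull [set a T; a S] (a T) by apply: convex_hull_gen; left.
rewrite eF => -[PT_T maxT].
have : convex_hull [set a T; a S] (a S) by apply: convex_hull_gen; right.
rewrite eF => -[PT_S maxS].
have gen U : convex_hull (range a) (a U) by apply: convex_hull_gen; exists U.
have eqST : inner c (a S) = inner c (a T).
  by apply/le_anti; rewrite maxT // maxS.
have incr : increasing_on T c.
  move=> [i j] ij /=; rewrite -subr_le0 -(pmulr_lle0 _ (rotated_shift_gt0 R ij)).
  by rewrite -inner_rotated subr_le0; apply: maxT; apply: gen.
have [[[i j] ij /= ge]|none] := pselect (exists2 e : 'I_n * 'I_n,
    e \in permutree_edges T & ~~ (c 0 e.1 < c 0 e.2)); last first.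
  case: TS; congr (a _); apply/esym/(permutree_of_cuts R) => e eT.
  apply: (increasing_on_max_cuts incr eqST eT).
  by apply: contrapT => /negP ge; apply: none; exists e.
exists i, j, ij; have eqR : inner c (a (rotated ij)) = inner c (a T).
  apply/eqP; rewrite -subr_eq0 inner_rotated mulf_eq0 subr_eq0; apply/orP; left.
  by rewrite eq_le (incr _ ij) leNgt.
have Rin : convex_hull [set a T; a S] (a (rotated ij)).
  by rewrite eF; split=> [|y /maxT]; [exact: gen | rewrite eqR].
apply/eqP; apply: contraT => SR.
have TR : T != rotated ij.
  apply/eqP => e; have := rotated_shift_gt0 R ij.
  by rewrite /rotated_shift -e subrr /mass big1 ?ltxx // => k _; rewrite mxE.
pose d := exposing_form R (rotated ij).
have : inner d (a (rotated ij)) < inner d (a (rotated ij)) \/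
    (set0 : set 'rV[R]_n) (a (rotated ij)).
  apply: (convex_hull_max (S := [set a T; a S])) => //.
  by move=> u [->|->]; left; apply: exposing_form_lt.
by case; rewrite ?ltxx.
Qed.

(** The form that jumps along all edges of [T] but the rotated one is maximal at [T]
    and at its rotation only. *)
Lemma rotated_edge T i j (ij : (i, j) \in permutree_edges T) :
  polytope_edge PT (a T) (a (rotated ij)).
Proof.
have TR : T <> rotated ij.
  move=> e; have := rotated_shift_gt0 R ij.
  by rewrite /rotated_shift -e subrr /mass big1 ?ltxx // => k _; rewrite mxE.
split; first by move/permutree_point_inj.
pose c := jump_form R T (predC1 (i, j)).
have incr : increasing_on T c by apply: jump_form_increasing.
have eqR : inner c (a (rotated ij)) = inner c (a T).
  apply/eqP; rewrite -subr_eq0 inner_rotated mulf_eq0 subr_eq0; apply/orP; left.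
  by rewrite (jump_formE _ _ ij) /= eqxx addr0.
apply: (face_of_max (c := c) (M := inner c (a T))).
- exact: convex_hull_convex.
- by exists (a T); apply: convex_hull_gen; left.
- apply: convex_hull_sub; first exact: convex_hull_convex.
  by move=> x [->|->]; apply: convex_hull_gen; [exists T | exists (rotated ij)].
- move=> x Hx; apply/le_anti/andP; split.
    by move: x Hx; apply: convex_hull_le => x [->|->]; rewrite ?eqR.
  rewrite -lerN2 -!innerN; move: x Hx; apply: convex_hull_le => x [->|->] //.
  by rewrite !innerN eqR.
move=> x [S _ <-].
have := increasing_on_max S incr; rewrite le_eqVlt => /orP[/eqP eqi|]; last by left.
right; apply: convex_hull_gen.
have [| -> | ->] := one_cut_rotated R ij (S := S); [|by left|by right].
by move=> f fT fe; apply: (jump_form_cuts eqi fT).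
Qed.

Lemma inner_direction_rotated T i j (ij : (i, j) \in permutree_edges T) :
  inner (direction R n) (a (rotated ij) - a T) =
  2 * ((j : nat)%:R - (i : nat)%:R) * rotated_shift R ij.
Proof.
rewrite innerBr inner_rotated !mxE; congr (_ * _).
by rewrite !natrB ?(ltnW (ltn_ord _)) // -!natr1; ring.
Qed.

End Skeleton.

Theorem proposition45 (R : realType) (n : nat) (delta : n.-tuple deco) :
  [/\ injective (@permutree_point R n delta),
      (forall p : 'rV[R]_n, polytope_vertex (permutreehedron R delta) p <->
         exists T : permutree delta, p = permutree_point R T),
      (forall p q : 'rV[R]_n, polytope_edge (permutreehedron R delta) p q ->
         inner (direction R n) (q - p)%R <> 0%R)
    & (forall T T' : permutree delta,
         oriented_edge (direction R n) (permutreehedron R delta)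
           (permutree_point R T) (permutree_point R T') <->
         permutree_hasse T T')].
Proof.
split.
- exact: permutree_point_inj.
- move=> p; split; first exact: vertex_permutree_point.
  by case=> T ->; apply: permutree_point_vertex.
- move=> p q pq; have [T [S [ep eq]]] := edge_permutree_points pq; subst p q.
  have [i [j [ij eS]]] := edge_rotated pq.
  rewrite eS inner_direction_rotated; apply/eqP.
  apply: mulf_neq0; last by rewrite gt_eqF ?rotated_shift_gt0.
  rewrite mulf_eq0 pnatr_eq0 /= subr_eq0 eqr_nat eq_sym; apply/eqP/val_neq.
  exact: (tree_neq (permutree_tree T) ij).
- move=> T S; rewrite permutree_hasseP increasing_rotationP; split.
    case=> /edge_rotated[i [j [ij eS]]]; rewrite eS inner_direction_rotated.
    rewrite pmulr_lgt0 ?rotated_shift_gt0 // pmulr_rgt0 ?ltr0n // subr_gt0 ltr_nat.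
    by exists i, j, ij.
  case=> i [j [ij [lt ->]]]; split; first exact: rotated_edge.
  rewrite inner_direction_rotated pmulr_lgt0 ?rotated_shift_gt0 //.
  by rewrite pmulr_rgt0 ?ltr0n // subr_gt0 ltr_nat.
Qed.
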